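(* Let $K_+=\{\nu\in\mathbb{R}^n:\nu_i\ge0,\ i=1,\dots,n\}$ and consider the two-sided likelihood ratio test of $H_0:\mu=0$ versus $H_1:\mu\in K_+$. (1) For $\mu=0$, $\mathbb{E}_0\Psi_{\mathrm{ts}}(Y;m_0,\sigma_0)=\alpha+\mathcal{O}(n^{-1/2})$. (2) For $\mu\in K_+$, $\mathbb{E}_\mu\Psi_{\mathrm{ts}}(Y;m_0,\sigma_0)\to1$ as $n\to\infty$ if and only if $\|\mu\|_1\vee\|\mu\|^2\gg n^{1/2}$.
   Context: Model: $Y=\mu+\xi$, $\xi$ standard Gaussian in $\mathbb{R}^n$; $\mathbb{E}_\mu$ refers to mean $\mu$; $\|\cdot\|$ is the Euclidean and $\|\cdot\|_1$ the $\ell_1$ norm. With $\Pi_{K_+}$ the metric projection onto $K_+$, $T(Y)=\|Y\|^2-\|Y-\Pi_{K_+}(Y)\|^2$; $m_0,\sigma_0^2$ are the mean and variance of $T(Y)$ under $\mu=0$. For fixed $\alpha\in(0,1)$, $\Psi_{\mathrm{ts}}(Y;m_0,\sigma_0)=\mathbf{1}\big(|T(Y)-m_0|/\sigma_0>z_{\alpha/2}\big)$ with $\mathbb{P}(\mathcal{N}(0,1)\ge z_\alpha)=\alpha$. $\mu$ is a sequence depending on $n$. For nonnegative sequences $a_n\gg b_n$ means $a_n/b_n\to\infty$; $a\vee b=\max\{a,b\}$. *)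

(* Defs.v *)
From HB Require Import structures.
From mathcomp Require Import all_boot all_order all_algebra.
From mathcomp Require Import all_classical all_reals all_analysis.

Set Implicit Arguments.
Unset Strict Implicit.
Unset Printing Implicit Defensive.

Import Order.TTheory GRing.Theory Num.Theory.
Import numFieldNormedType.Exports.

Local Open Scope classical_set_scope.
Local Open Scope ring_scope.

(* The library norm `|x| on 'rV[R]_n is the sup norm, so the Euclidean and
   l1 norms are defined here. *)
Definition norm2 (R : realType) (n : nat) (x : 'rV[R]_n) : R :=
  Num.sqrt (\sum_(i < n) x 0 i ^+ 2).

Definition norm1 (R : realType) (n : nat) (x : 'rV[R]_n) : R :=
  \sum_(i < n) `|x 0 i|.

Definition orthant (R : realType) (n : nat) : set 'rV[R]_n :=
  [set v | forall i, 0 <= v 0 i].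
Arguments orthant : clear implicits.

(* The nearest point of K to y; it is unique when K is a nonempty closed convex
   set.  (The value 0 is taken when no nearest point exists.) *)
Definition metric_proj (R : realType) (n : nat) (K : set 'rV[R]_n)
    (y : 'rV[R]_n) : 'rV[R]_n :=
  xget 0 [set x | K x /\ forall v, K v -> norm2 (y - x) <= norm2 (y - v)].

Definition lrs (R : realType) (n : nat) (K : set 'rV[R]_n) (y : 'rV[R]_n) : R :=
  norm2 y ^+ 2 - norm2 (y - metric_proj K y) ^+ 2.

(* z is the critical value z_{alpha/2}; m and s are the centring and scaling
   constants. *)
Definition psi_ts (R : realType) (n : nat) (K : set 'rV[R]_n) (z m s : R)
  : 'rV[R]_n -> R :=
  \1_[set y | z < `|lrs K y - m| / s].

Definition upper_quantile (R : realType) (a z : R) : Prop :=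
  normal_prob 0 1 `[z, +oo[ = a%:E.

Definition mutually_independent (d : measure_display) (T : measurableType d)
    (R : realType) (P : probability T R) (n : nat)
    (xi : 'I_n -> {RV P >-> R}) : Prop :=
  forall (J : {set 'I_n}) (B : 'I_n -> set R), (forall i, measurable (B i)) ->
    P (\bigcap_(i in [set` J]) (xi i @^-1` B i)) =
    (\prod_(i in J) P (xi i @^-1` B i))%E.

Definition standard_gaussian (d : measure_display) (T : measurableType d)
    (R : realType) (P : probability T R) (n : nat)
    (xi : 'I_n -> {RV P >-> R}) : Prop :=
  (forall i (B : set R), measurable B ->
     distribution P (xi i) B = normal_prob 0 1 B) /\
  mutually_independent xi.

Section gaussian_model.
Context (d : measure_display) (T : measurableType d) (R : realType).
Context (P : probability T R) (n : nat) (xi : 'I_n -> {RV P >-> R}).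

Definition observation (mu : 'rV[R]_n) (w : T) : 'rV[R]_n :=
  mu + \row_i xi i w.

(* E_mu f(Y), the expectation of f(Y) when Y = mu + xi. *)
Definition expect (mu : 'rV[R]_n) (f : 'rV[R]_n -> R) : R :=
  fine 'E_P[f \o observation mu].

Definition null_mean (K : set 'rV[R]_n) : R := expect 0 (lrs K).

Definition null_sd (K : set 'rV[R]_n) : R :=
  Num.sqrt (fine ('V_P[lrs K \o observation 0])).

End gaussian_model.

Definition much_greater (R : realType) (a b : nat -> R) : Prop :=
  a n / b n @[n --> \oo] --> +oo.

(* Main.v *)
Require Import Defs.
From HB Require Import structures.
From mathcomp Require Import all_boot all_order all_algebra.
From mathcomp Require Import all_classical all_reals all_analysis.
From mathcomp Require Import measurable_realfun.
From mathcomp Require Import ring lra.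

Set Implicit Arguments.
Unset Strict Implicit.
Unset Printing Implicit Defensive.

Import Order.TTheory GRing.Theory Num.Theory.
Import numFieldNormedType.Exports.

Local Open Scope classical_set_scope.
Local Open Scope ring_scope.

(** The projection onto the orthant is the coordinatewise positive part, so that
    [T(Y)] is the sum of the [pos2 (mu_i + xi_i)], where [pos2 x = max(x, 0) ^ 2]
    ([lrs_orthant]).  With [p] and [s] the mean and standard deviation of
    [pos2 (xi_i)], this gives ([lrs_decomp])

      [(T(Y) - m_0) / s = W + Z + drift],

    where [W] is the sum of the [(pos2 (xi_i) - p) / s], and [Z] and [drift] are
    the centred part and the mean of the sum of the increments
    [(pos2 (mu_i + xi_i) - pos2 (xi_i)) / s].  The test rejects when this
    quantity exceeds [z * sqrt n] in absolute value.

    For [mu = 0] only [W], a sum of [n] independent, identically distributed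
    variables, is left, and the error of the level is a Berry-Esseen error
    ([level_bound]).

    For [mu] in the orthant, let [M] be the larger of its l1 norm and its squared
    Euclidean norm.  A nonnegative shift [a] increases [pos2] by an amount whose
    mean lies between multiples of [2 * a + a ^ 2], and whose variance is at most
    a multiple of [a ^ 2] because the increment differs from [a ^ 2] by at most
    [2 * a * |x|].  Hence [drift] has exactly the order of [M], and the variance
    of [Z] is at most of order [M].  If [M] is large compared with [sqrt n],
    Chebyshev's inequality shows that neither [W], of variance [n], nor [Z] can
    compensate the drift ([power_bound]).  If [M <= L * sqrt n], then
    [drift / sqrt n] is bounded; by the Berry-Esseen bound [W / sqrt n] falls into
    an interval of length [z] around its opposite with a probability bounded
    below, and [Z] is negligible, so that the power stays away from 1
    ([accept_bound]).  This happens for infinitely many [n] unless [M] is large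
    compared with [sqrt n].

    The Berry-Esseen bound [berry_esseen] is proved for a law with a fourth moment
    by Stein's method and Bolthausen's induction on the number of variables.  The
    indicator of a half-line is replaced by a ramp [h] of width [la].  Stein's
    equation [f' - x * f = h - gmean h] has a bounded solution, and exchangeability
    ([Rint_iid_sum_exchange]) turns [E h(S / sqrt n) - gmean h] into an expected
    variation of [f'] over a step of order [1 / sqrt n] ([stein_error]).  This
    variation is small except when the sum of the other variables is near the
    slope of the ramp, and the probability of that is bounded by means of the
    estimate for one variable less.  With [la] a large multiple of [1 / sqrt n],
    an error [C / sqrt n] reproduces itself.

    Sums of independent variables are treated through their laws, which are
    iterated convolutions ([psum_indep]). *)

(** * Laws of sums of independent variables *)
Section conv.
Context {R : realType}.
Implicit Types l r : probability R R.

Definition addp (p : R * R) : R := p.1 + p.2.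

Lemma measurable_addp : measurable_fun setT addp.
Proof. exact: measurable_realfun.measurable_funD. Qed.

HB.instance Definition _ := isMeasurableFun.Build _ _ _ _ addp measurable_addp.

Section prod_law.
Variables l r : probability R R.
Definition prod_law : set (R * R) -> \bar R := (l \x r)%E.
HB.instance Definition _ := Measure.on prod_law.
Let prod_lawT : prod_law setT = 1%E.
Proof.
rewrite /prod_law -setXTT product_measure1E//.
have lT := probability_setT l; have rT := probability_setT r.
by rewrite [X in (X * _)%E]lT [X in (_ * X)%E]rT mule1.
Qed.
HB.instance Definition _ := Measure_isProbability.Build _ _ _ prod_law prod_lawT.
End prod_law.

Definition conv l r : probability R R := distribution (prod_law l r) addp.

Definition sum_law (rs : seq (probability R R)) : probability R R :=
  foldr (fun r l => conv l r) (\d_(0 : R) : probability R R) rs.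

Lemma integrable_conv l r (f : R -> \bar R) : measurable_fun setT f ->
  (conv l r).-integrable setT f <->
  (l \x r)%E.-integrable setT (fun p : R * R => f (addp p)).
Proof.
move=> mf; split => [/integrableP[_ fi]|fi].
  apply/integrableP; split; first exact: measurableT_comp.
  move: fi; rewrite ge0_integral_distribution//; exact: measurableT_comp.
exact: integrable_pushforward.
Qed.

Lemma integral_conv l r (f : R -> \bar R) :
  (conv l r).-integrable setT f -> measurable_fun setT f ->
  (\int[conv l r]_x f x = \int[l \x r]_p f (p.1 + p.2)%R)%E.
Proof.
move=> fi mf; rewrite /conv integral_distribution//.
exact/integrable_conv.
Qed.
End conv.

(** The law of a sum is handled through iterated convolution, on which Fubini's
    theorem acts; this section ties it to independence of variables on an
    arbitrary probability space. *)
Section independence.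
Context (R : realType) (d : measure_display) (T : measurableType d).
Context (P : probability T R) (n : nat) (xi : 'I_n -> {RV P >-> R}).
Hypothesis ind : mutually_independent xi.
Variables (g : 'I_n -> {mfun R >-> R}) (rho : 'I_n -> probability R R).
Hypothesis rhoE : forall i A, measurable A -> P (xi i @^-1` (g i @^-1` A)) = rho i A.

Definition psum (s : seq 'I_n) (w : T) : R := \sum_(i <- s) g i (xi i w).

Lemma measurable_psum s : measurable_fun setT (psum s).
Proof.
apply: measurable_sum => i.
exact: measurableT_comp.
Qed.

HB.instance Definition _ s := isMeasurableFun.Build _ _ _ _ (psum s) (measurable_psum s).

Definition cylinder (J : {set 'I_n}) (B : 'I_n -> set R) : set T :=
  \bigcap_(i in [set` J]) (xi i @^-1` B i).

Lemma measurable_cylinder J B : (forall i, measurable (B i)) -> measurable (cylinder J B).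
Proof.
move=> mB; apply: fin_bigcap_measurable => // i _.
by rewrite -[X in measurable X]setTI; exact: measurable_funP.
Qed.

Lemma cylinderU1 (J : {set 'I_n}) B i C : i \notin J ->
  cylinder (i |: J) (fun j => if j == i then C else B j) =
  xi i @^-1` C `&` cylinder J B.
Proof.
move=> iJ; apply/seteqP; split => w /=.
  move=> cw; split.
    by have := cw i; rewrite /= eqxx; apply; rewrite setU11.
  move=> j /= jJ; have := cw j; rewrite /= ifN; first by apply; rewrite setU1r.
  by apply: contraNneq iJ => <-.
move=> [wC wJ] j /=; rewrite in_setU1; case: eqP => [-> //|_ /= jJ].
exact: wJ.
Qed.

(** The induction over the list must also carry independence of the partial sum
    from the variables outside the list, whence the cylinder.  The pair formed by
    the partial sum over [s] and the next summand has, conditionally on the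
    cylinder, a law which agrees on rectangles with a product law: the induction
    hypothesis applies to the cylinder that also constrains the next variable.
    Uniqueness of the product measure then identifies the law of the pair. *)
Lemma psum_indep s (J : {set 'I_n}) B A : uniq s -> {in s, forall i, i \notin J} ->
  (forall i, measurable (B i)) -> measurable A ->
  P (psum s @^-1` A `&` cylinder J B) =
  (sum_law (map rho s) A * P (cylinder J B))%E.
Proof.
elim: s J B A => [|i s IH] J B A /=.
  move=> _ _ mB mA.
  have -> : psum [::] = cst 0 by apply/funext => w; rewrite /psum big_nil.
  rewrite preimage_cst /dirac/= indicE.
  by case: ifPn => _; rewrite ?setTI ?set0I ?measure0 ?mul1e ?mul0e.
move=> /andP[is_ us] dis mB mA.
have iJ : i \notin J by apply: dis; rewrite mem_head.
have mE := measurable_cylinder J mB.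
set E := cylinder J B in mE *.
have [PE0|PE0] := eqVneq (P E) 0%E.
  rewrite PE0 mule0; apply/eqP; rewrite eq_le measure_ge0 andbT -PE0.
  apply: le_measure => //; rewrite inE //; apply: measurableI => //.
  by rewrite -[X in measurable X]setTI; exact: measurable_funP.
have PEfin : P E \is a fin_num by rewrite fin_num_measure.
have PE_ge0 : 0 <= (fine (P E))^-1 by rewrite invr_ge0 fine_ge0.
pose pr w := (psum s w, g i (xi i w)).
have mpr : measurable_fun setT pr.
  apply: measurable_fun_pair; first exact: measurable_psum.
  exact: measurableT_comp.
(* [m1] is [P] conditioned on [E], and [m'] the conditional law of the pair. *)
pose m1 := mscale (NngNum PE_ge0) (mrestr P mE).
pose m' : {measure set (R * R) -> \bar R} :=
  measure_function_pushforward__canonical__measure_function_Measure m1 mpr.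
have m'E X : m' X = ((fine (P E))^-1%:E * P (pr @^-1` X `&` E))%E by [].
have PEK : ((fine (P E))^-1%:E * P E = 1)%E.
  by rewrite -[X in (_ * X)%E](fineK PEfin) -EFinM mulVf // fine_eq0.
have m'X C D : measurable C -> measurable D ->
    m' (C `*` D) = (sum_law (map rho s) C * rho i D)%E.
  move=> mC mD; rewrite m'E.
  have mgD : measurable (g i @^-1` D) by rewrite -[X in measurable X]setTI; exact: measurable_funP.
  have -> : pr @^-1` (C `*` D) `&` E =
      psum s @^-1` C `&` cylinder (i |: J) (fun j => if j == i then g i @^-1` D else B j).
    by rewrite cylinderU1// setIA.
  rewrite IH//; last 2 first.
  - move=> j js; rewrite in_setU1 negb_or; apply/andP; split.
      by apply: contraNneq is_ => <-.
    by apply: dis; rewrite in_cons js orbT.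
  - by move=> j; case: ifP.
  rewrite [X in (_ * (_ * X))%E](_ : _ = rho i D * P E)%E; last first.
    rewrite /E /cylinder !ind//; last by move=> j; case: ifP.
    rewrite big_setU1//= eqxx rhoE//; congr (_ * _)%E.
    by apply: eq_bigr => j jJ; rewrite ifN//; apply: contraNneq iJ => <-.
  by rewrite muleCA [X in (_ * X)%E]muleCA PEK mule1.
have mA' : measurable (addp @^-1` A).
  by rewrite -[X in measurable X]setTI; exact: measurable_addp.
have cA : conv (sum_law [seq rho j | j <- s]) (rho i) A = m' (addp @^-1` A).
  exact: (product_measure_unique m'X mA').
rewrite [X in _ = (X * _)%E]cA m'E muleAC PEK mul1e; congr (P (_ `&` _)).
by apply/seteqP; split => w; rewrite /= /addp /psum big_cons addrC.
Qed.
End independence.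

Section sumg_law.
Context (R : realType) (d : measure_display) (T : measurableType d).
Context (P : probability T R) (n : nat) (xi : 'I_n -> {RV P >-> R}).
Hypothesis ind : mutually_independent xi.
Variables (g : 'I_n -> {mfun R >-> R}) (rho : 'I_n -> probability R R).
Hypothesis rhoE : forall i A, measurable A -> P (xi i @^-1` (g i @^-1` A)) = rho i A.

Lemma psum_lawE A : measurable A ->
  P ((fun w => \sum_(i < n) g i (xi i w)) @^-1` A) =
  sum_law (map rho (index_enum 'I_n)) A.
Proof.
move=> mA.
have disj : {in index_enum 'I_n, forall i : 'I_n, i \notin (finset.set0 : {set 'I_n})}.
  by move=> i _; rewrite inE.
have := psum_indep ind rhoE (index_enum_uniq _) disj (fun=> @measurableT _ _) mA.
have -> : cylinder xi finset.set0 (fun=> setT) = setT.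
  by apply/seteqP; split => // w _ i /=; rewrite inE.
by rewrite setIT (probability_setT P) mule1.
Qed.
End sumg_law.

(** * Integration against probability laws *)
Section Rint.
Context (d : measure_display) (T : measurableType d) (R : realType).
Variable mu : probability T R.
Implicit Types f g : T -> R.
Local Notation Int f := (mu.-integrable setT (EFin \o f)).

Lemma int_dom f g : measurable_fun setT f -> (forall x, `|f x| <= g x) ->
  Int g -> Int f.
Proof.
move=> mf fg; apply: le_integrable => //; first exact/measurable_EFinP.
by move=> x _ /=; rewrite lee_fin (le_trans (fg x))// ler_norm.
Qed.

Lemma int_cst c : Int (cst c).
Proof. exact: finite_measure_integrable_cst. Qed.

Lemma int_bounded f M : measurable_fun setT f -> (forall x, `|f x| <= M) -> Int f.
Proof. by move=> mf fM; apply: (int_dom mf fM); exact: int_cst. Qed.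

Lemma intD f g : Int f -> Int g -> Int (fun x => f x + g x).
Proof. by move=> fi gi; exact: (integrableD measurableT fi gi). Qed.

Lemma intB f g : Int f -> Int g -> Int (fun x => f x - g x).
Proof. by move=> fi gi; exact: (integrableB measurableT fi gi). Qed.

Lemma intZ c f : Int f -> Int (fun x => c * f x).
Proof. by move=> fi; exact: (integrableZl measurableT c fi). Qed.

Lemma int_norm f : Int f -> Int (fun x => `|f x|).
Proof. by move=> fi; exact: integrable_norm. Qed.

Lemma int_meas f : Int f -> measurable_fun setT f.
Proof. by move=> /measurable_int/measurable_EFinP. Qed.

Lemma Rint_cst c : \int[mu]_x c = c.
Proof. by rewrite Rintegral_cst//= probability_setT mulr1. Qed.

Lemma le_Rint f g : Int f -> Int g -> (forall x, f x <= g x) ->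
  \int[mu]_x f x <= \int[mu]_x g x.
Proof. by move=> fi gi fg; exact: le_Rintegral. Qed.

Lemma Rint_norm_le f g : Int f -> Int g -> (forall x, `|f x| <= g x) ->
  `|\int[mu]_x f x| <= \int[mu]_x g x.
Proof.
move=> fi gi fg; apply: le_trans (le_normr_Rintegral _ _) _ => //.
by apply: le_Rint => //; exact: int_norm.
Qed.

Lemma RintD f g : Int f -> Int g ->
  \int[mu]_x (f x + g x) = \int[mu]_x f x + \int[mu]_x g x.
Proof. exact: RintegralD. Qed.

Lemma RintB f g : Int f -> Int g ->
  \int[mu]_x (f x - g x) = \int[mu]_x f x - \int[mu]_x g x.
Proof. exact: RintegralB. Qed.

Lemma RintZ c f : Int f -> \int[mu]_x (c * f x) = c * \int[mu]_x f x.
Proof. exact: RintegralZl. Qed.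

Lemma int_indic (A : set T) : measurable A -> Int (\1_A : T -> R).
Proof. by move=> mA; exact: integrable_indic. Qed.

Lemma Rint_indic (A : set T) : measurable A -> \int[mu]_x \1_A x = fine (mu A).
Proof. by move=> mA; rewrite /Rintegral integral_indic// setIT. Qed.
End Rint.

(** All the integrands on product spaces below are dominated by a product of two
    integrable functions of one variable, and this is the form of Fubini's
    theorem that they use. *)
Section product_domination.
Context (R : realType) (l r : probability R R).
Variables (F : R * R -> R) (a b : R -> R).
Hypothesis mF : measurable_fun setT F.
Hypothesis Fab : forall u x, `|F (u, x)| <= a u * b x.
Hypothesis ai : l.-integrable setT (EFin \o a).
Hypothesis bi : r.-integrable setT (EFin \o b).

Let meF : measurable_fun setT (EFin \o F).
Proof. exact/measurable_EFinP. Qed.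

Lemma int_section1 u : r.-integrable setT (EFin \o (fun x => F (u, x))).
Proof.
apply: (int_dom (g := fun x => a u * b x)) => //.
  by apply: measurableT_comp => //; exact: pair1_measurable.
exact: intZ.
Qed.

Lemma int_section2 x : l.-integrable setT (EFin \o (fun u => F (u, x))).
Proof.
apply: (int_dom (g := fun u => b x * a u)) => //.
- by apply: measurableT_comp => //; exact: pair2_measurable.
- by move=> u; rewrite mulrC.
exact: intZ.
Qed.

Let E1 u : (\int[r]_x (F (u, x))%:E)%E = (\int[r]_x F (u, x))%:E.
Proof. by rewrite fineK//; apply: integrable_fin_num => //; exact: int_section1. Qed.

Let E2 x : (\int[l]_u (F (u, x))%:E)%E = (\int[l]_u F (u, x))%:E.
Proof. by rewrite fineK//; apply: integrable_fin_num => //; exact: int_section2. Qed.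

Let ab0 u x : 0 <= a u * b x.
Proof. exact: le_trans (normr_ge0 _) (Fab u x). Qed.

Let intab u : r.-integrable setT (EFin \o (fun x => a u * b x)).
Proof. exact: intZ. Qed.

Lemma int_prod_dom : (l \x r)%E.-integrable setT (EFin \o F).
Proof.
apply/(integrable12ltyP _ _ meF).
have aB0 u : 0 <= a u * \int[r]_x b x.
  by rewrite -RintegralZl//; apply: Rintegral_ge0 => x _.
have aBi : l.-integrable setT (EFin \o (fun u => (\int[r]_x b x) * a u)).
  exact: intZ.
apply: (@le_lt_trans _ _ (\int[l]_u (a u * \int[r]_x b x)%:E)%E); last first.
  move/integrableP : aBi => [_]; apply: le_lt_trans.
  rewrite le_eqVlt; apply/orP; left; apply/eqP/eq_integral => u _.
  by rewrite /= [X in `|X|]mulrC ger0_norm// aB0.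
apply: ge0_le_integral => //.
- by move=> u _; exact: integral_ge0.
- apply: (@measurable_fun_fubini_tonelli_F _ _ _ _ R r (fun p => `|(F p)%:E|)%E) => //.
  exact: measurableT_comp.
- apply/measurable_EFinP; apply: measurable_funM => //; exact: int_meas ai.
- move=> u _.
  have -> : ((a u * \int[r]_x b x)%:E = \int[r]_x (a u * b x)%:E)%E.
    rewrite -RintegralZl// fineK//; apply: integrable_fin_num => //; exact: intab.
  apply: ge0_le_integral => //.
  + by apply: measurableT_comp => //; case/integrableP: (int_section1 u).
  + by case/integrableP: (intab u).
  + by move=> x _; rewrite lee_fin.
Qed.

Lemma int_marginal1 : l.-integrable setT (EFin \o (fun u => \int[r]_x F (u, x))).
Proof.
have := integrable_fubini_F int_prod_dom; apply: eq_integrable => // u _.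
by rewrite /= -E1.
Qed.

Lemma Rint_prod : \int[(l \x r)%E]_p F p = \int[r]_x \int[l]_u F (u, x).
Proof.
rewrite /Rintegral -(integral21_prod_meas1 int_prod_dom); congr fine.
by apply: eq_integral => x _; rewrite -E2.
Qed.

Lemma Rint_exchange : \int[l]_u \int[r]_x F (u, x) = \int[r]_x \int[l]_u F (u, x).
Proof.
rewrite -Rint_prod /Rintegral -(integral12_prod_meas1 int_prod_dom); congr fine.
by apply: eq_integral => u _; rewrite -E1.
Qed.
End product_domination.

Lemma int_marginal2 (R : realType) (l r : probability R R) (F : R * R -> R) (a b : R -> R) :
  measurable_fun setT F -> (forall u x, `|F (u, x)| <= a u * b x) ->
  l.-integrable setT (EFin \o a) -> r.-integrable setT (EFin \o b) ->
  r.-integrable setT (EFin \o (fun x => \int[l]_u F (u, x))).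
Proof.
move=> mF Fab ai bi.
apply: (@int_marginal1 _ r l (fun p => F (p.2, p.1)) b a) => //.
  apply: measurableT_comp => //; exact: measurable_swap.
by move=> x u /=; rewrite mulrC.
Qed.

Section Rconv.
Context (R : realType) (l r : probability R R).
Variables (f : R -> R) (a b : R -> R).
Hypothesis mf : measurable_fun setT f.
Hypothesis fab : forall u x, `|f (u + x)| <= a u * b x.
Hypothesis ai : l.-integrable setT (EFin \o a).
Hypothesis bi : r.-integrable setT (EFin \o b).

Let mF : measurable_fun setT (fun p : R * R => f (p.1 + p.2)).
Proof. by apply: measurableT_comp => //; exact: measurable_addp. Qed.

Lemma int_conv : (conv l r).-integrable setT (EFin \o f).
Proof.
apply/integrable_conv; first exact/measurable_EFinP.
exact: (@int_prod_dom _ _ _ (fun p => f (p.1 + p.2)) a b).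
Qed.

Lemma Rint_conv : \int[conv l r]_s f s = \int[r]_x \int[l]_u f (u + x).
Proof.
rewrite -(@Rint_prod _ l r (fun p => f (p.1 + p.2)) a b)//.
rewrite /Rintegral; congr fine.
by rewrite (integral_conv int_conv)//; exact/measurable_EFinP.
Qed.
End Rconv.

(** * The Gaussian density and Stein's equation *)
Section gaussian.
Context {R : realType}.
Notation leb := (@lebesgue_measure R).
Notation phi := (@normal_pdf R 0 1).
Notation Lint D f := (leb.-integrable D (EFin \o f)).

Lemma phiE x : phi x = normal_peak 1 * expR (- x ^+ 2 / 2).
Proof. by rewrite normal_pdfE ?oner_eq0// /normal_fun subr0 expr1n. Qed.

Lemma phi_gt0 x : 0 < phi x.
Proof. by rewrite phiE mulr_gt0 ?expR_gt0// normal_peak_gt0// oner_eq0. Qed.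

Lemma phiN x : phi (- x) = phi x.
Proof. by rewrite !phiE sqrrN. Qed.

Lemma le_phi x y : `|x| <= `|y| -> phi y <= phi x.
Proof.
move=> xy; rewrite !phiE ler_pM2l ?normal_peak_gt0 ?oner_eq0// ler_expR.
rewrite ler_pM2r ?invr_gt0// lerN2 -(real_normK (num_real x)) -(real_normK (num_real y)).
by rewrite lerXn2r ?nnegrE.
Qed.

Lemma phi_upper_tail x : (\int[leb]_(u in `[x, +oo[) (phi u)%:E =
  \int[leb]_(u in `]-oo, (- x)%R]) (phi u)%:E)%E.
Proof.
rewrite ge0_integration_by_substitutionNy.
- by apply: eq_integral => u _ /=; rewrite phiN.
- by apply: continuous_subspaceT; apply: continuous_normal_pdf; rewrite oner_eq0.
- by move=> u _; rewrite ltW// phi_gt0.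
Qed.

Lemma peak_le1 : normal_peak (1 : R) <= 1.
Proof.
have pi2 : (1 : R) <= pi *+ 2 by have := pi_ge2 R; rewrite mulr2n; lra.
have pi0 : (0 : R) < pi *+ 2 by apply: lt_le_trans pi2.
by rewrite /normal_peak expr1n mul1r invf_le1 ?sqrtr_gt0// -[leLHS]sqrtr1 ler_sqrt// ltW.
Qed.

Lemma phi_le1 x : phi x <= 1.
Proof. by apply: le_trans (normal_pdf_ub _ _ _) peak_le1; rewrite oner_eq0. Qed.

Lemma integrable_phi D : measurable D -> Lint D phi.
Proof.
move=> mD; apply: integrableS (integrable_normal_pdf 0 1) => //.
Qed.

Lemma measurable_phi (D : set (measurableTypeR R)) : measurable D -> measurable_fun D phi.
Proof.
by move=> mD; apply/measurable_EFinP; apply: (measurable_int leb); exact: integrable_phi.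
Qed.

Lemma is_derive_phi (x : R) : is_derive x 1 (phi : R -> R) (- x * phi x).
Proof.
have -> : phi = (fun x => normal_peak 1 * expR (- x ^+ 2 / 2)).
  by apply/funext => y; rewrite phiE.
have H : is_derive x 1 (fun x : R => - x ^+ 2 / 2) (- x).
  apply: is_derive_eq.
  rewrite /GRing.scale/=; lra.
have H2 : is_derive x 1 (fun x : R => expR (- x ^+ 2 / 2)) (expR (- x ^+ 2 / 2) * - x).
  exact: (@is_derive1_comp _ expR (fun x : R => - x ^+ 2 / 2)).
apply: is_derive_eq.
rewrite /GRing.scale/=; lra.
Qed.

Lemma continuous_phi : continuous phi.
Proof. by apply: continuous_normal_pdf; rewrite oner_eq0. Qed.

(** Since [x <= x ^+ 2] beyond 1 and [1 + y <= expR y], the density is at most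
    [2 / x]. *)
Lemma cvg_phi : phi x @[x --> +oo] --> 0.
Proof.
rewrite (_ : phi = fun x => normal_peak 1 * expR (- x ^+ 2 / 2)); last first.
  by apply/funext => y; rewrite phiE.
rewrite -(mulr0 (normal_peak 1)); apply: cvgM; first exact: cvg_cst.
apply: (@squeeze_cvgr _ _ _ _ (cst 0) (fun x => 2 * x^-1)).
- near=> x.
  have x0 : 0 < x by near: x; exact: nbhs_pinfty_gt.
  have x1 : 1 < x by near: x; exact: nbhs_pinfty_gt.
  rewrite expR_ge0/= mulNr expRN.
  rewrite -[leRHS]invrK lef_pV2 ?posrE ?expR_gt0 ?invr_gt0 ?divr_gt0//.
  apply: le_trans (expR_ge1Dx _).
  rewrite invfM invrK.
  have : x <= x ^+ 2 by rewrite expr2 ler_peMr// ltW.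
  lra.
- exact: cvg_cst.
- rewrite -(mulr0 2); apply: cvgM; first exact: cvg_cst.
  by apply/gtr0_cvgV0; [exact: nbhs_pinfty_gt|exact: cvg_id].
Unshelve. all: by end_near. Qed.

Definition tail_const : R := 1 + (phi 1)^-1.

(** On [[x, +oo[] one has [x * phi u <= u * phi u], and [- phi] is a primitive of
    [u * phi u]. *)
Lemma mills_ineq (x : R) : 0 <= x ->
  x * \int[leb]_(u in `[x, +oo[) phi u <= phi x.
Proof.
move=> x0.
have I : (\int[leb]_(u in `[x, +oo[) (u * phi u)%:E = 0%:E - (- phi x)%:E)%E.
  apply: (@ge0_continuous_FTC2y _ (fun u => u * phi u) (fun u => - phi u) x 0).
  - by move=> u xu; rewrite mulr_ge0 ?(ltW (phi_gt0 _))// (le_trans x0).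
  - apply: continuous_subspaceT => u; apply: cvgM => //; exact: continuous_phi.
  - rewrite -[X in _ --> X]oppr0; apply: cvgN; exact: cvg_phi.
  - move=> u _; have := is_derive_phi u; by [].
  - apply: cvg_at_right_filter; apply: cvgN; exact: continuous_phi.
  - move=> u _; have H := is_derive_phi u; rewrite derive1E derive_val; lra.
have <- : \int[leb]_(u in `[x, +oo[) (u * phi u) = phi x.
  by rewrite /Rintegral I /= sub0r opprK.
rewrite -RintegralZl//; last exact: integrable_phi.
apply: le_Rintegral => //.
- exact: (integrableZl _ x (integrable_phi _)).
- apply/integrableP; split.
    apply/measurable_EFinP; apply: measurable_funM => //.
    exact: measurable_phi.
  rewrite [ltLHS](_ : _ = \int[leb]_(u in `[x, +oo[) (u * phi u)%:E)%E; first by rewrite I ltry.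
  apply: eq_integral => u; rewrite inE/= in_itv/= andbT => xu.
  by rewrite ger0_norm// mulr_ge0 ?(ltW (phi_gt0 _))// (le_trans x0).
- by move=> u /=; rewrite in_itv/= andbT => xu; rewrite ler_pM2r ?phi_gt0.
Qed.

Lemma Rint_phi_le1 D : measurable D -> \int[leb]_(u in D) phi u <= 1.
Proof.
move=> mD; rewrite -lee_fin fineK; last exact: integrable_fin_num (integrable_phi mD).
exact: (@probability_le1 _ _ _ (normal_prob 0 1)).
Qed.

(** Beyond 1 this is Mills' inequality; below 1 the density is at least [phi 1],
    which explains the constant. *)
Lemma phi_tail_le (x : R) : 0 <= x ->
  \int[leb]_(u in `[x, +oo[) phi u <= tail_const * phi x.
Proof.
move=> x0; have p0 := phi_gt0 x; have p1 := phi_gt0 1.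
have i1 : 0 <= (phi 1)^-1 by rewrite invr_ge0 ltW.
rewrite /tail_const mulrDl mul1r.
have [x1|x1] := leP 1 x.
  apply: (@le_trans _ _ (phi x)); last by rewrite lerDl mulr_ge0// ltW.
  apply: le_trans (mills_ineq x0); rewrite ler_peMl//.
  by apply: Rintegral_ge0 => u _; rewrite ltW// phi_gt0.
apply: (le_trans (Rint_phi_le1 _)) => //.
apply: (@le_trans _ _ ((phi 1)^-1 * phi x)); last by rewrite lerDr ltW.
by rewrite ler_pdivlMl// mulr1 le_phi// !ger0_norm// ltW.
Qed.

Section stein.
Variable h : R -> R.
Hypothesis ch : continuous h.
Hypothesis h01 : forall x, 0 <= h x <= 1.

Definition gmean := \int[leb]_u (h u * phi u).

Lemma gmean_int D : measurable D -> Lint D (fun u => h u * phi u).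
Proof.
move=> mD; have [mh mp] : measurable_fun D h /\ measurable_fun D phi.
  split; first by apply: measurable_funTS; exact: continuous_measurable_fun.
  exact: measurable_phi.
apply: le_integrable (integrable_phi mD) => //.
  by apply/measurable_EFinP; apply: measurable_funM.
move=> x _ /=; rewrite lee_fin normrM ler_piMl// ger0_norm; by case/andP: (h01 x).
Qed.

Let H01 : 0 <= gmean <= 1.
Proof.
apply/andP; split.
  by apply: Rintegral_ge0 => u _; rewrite mulr_ge0 ?(ltW (phi_gt0 _))//; case/andP: (h01 u).
apply: le_trans (Rint_phi_le1 measurableT).
apply: le_Rintegral => //; [exact: gmean_int|exact: integrable_phi|] => u _.
by rewrite ler_piMl ?(ltW (phi_gt0 _))//; case/andP: (h01 u).
Qed.

Let k u := (h u - gmean) * phi u.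

Let k_le u : `|k u| <= phi u.
Proof.
rewrite normrM (gtr0_norm (phi_gt0 _)) ler_piMl ?(ltW (phi_gt0 _))// ler_norml.
by case/andP: (h01 u); case/andP: H01; lra.
Qed.

Let k_int D : measurable D -> Lint D k.
Proof.
move=> mD; apply: le_integrable (integrable_phi mD) => //.
  apply/measurable_EFinP; apply: measurable_funM.
    apply: measurable_funB => //; apply: measurable_funTS; exact: continuous_measurable_fun.
  exact: measurable_phi.
by move=> x _ /=; rewrite lee_fin (le_trans (k_le x))// ler_norm.
Qed.

Let k_tot : \int[leb]_u k u = 0.
Proof.
rewrite /k; under eq_Rintegral do rewrite mulrBl.
rewrite RintegralB//; [|exact: gmean_int|exact: (integrableZl _ gmean (integrable_phi _))].
rewrite RintegralZl//; last exact: integrable_phi.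
by rewrite -/gmean /Rintegral integral_normal_pdf mulr1 subrr.
Qed.

Let F x := \int[leb]_(u in `]-oo, x]) k u.

Let F_le D : measurable D -> `|\int[leb]_(u in D) k u| <= \int[leb]_(u in D) phi u.
Proof.
move=> mD; apply: le_trans (le_normr_Rintegral _ _) _ => //; first exact: k_int.
apply: le_Rintegral => //; [|exact: integrable_phi].
apply: (integrable_norm (k_int mD)).
Qed.

(* As [k] integrates to 0, its primitive may be computed from the tail that does
   not contain the origin. *)
Let Ftail x : `|F x| <= \int[leb]_(u in `[`|x|, +oo[) phi u.
Proof.
have [x0|x0] := leP 0 x.
  have -> : F x = - \int[leb]_(u in `[x, +oo[) k u.
    have := @Rintegral_itvB R k -oo%O +oo%O x.
    move=> /(_ (k_int (measurable_itv _)) isT isT).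
    rewrite set_itvNyy k_tot sub0r -/(F x) => E.
    by rewrite -[LHS]opprK E Rintegral_itv_obnd_cbnd//; exact: k_int.
  by rewrite normrN (ger0_norm x0); exact: F_le.
rewrite (ltr0_norm x0); apply: le_trans (F_le _) _ => //.
by rewrite /Rintegral phi_upper_tail opprK.
Qed.

(** The solutions of [f' x - x * f x = h x - gmean] differ by constant multiples of
    [1 / phi]; this one stays bounded at both ends. *)
Definition stein_f x := F x / phi x.

Lemma stein_f_le x : `|stein_f x| <= tail_const.
Proof.
rewrite normrM normfV (gtr0_norm (phi_gt0 _)) ler_pdivrMr ?phi_gt0//.
apply: le_trans (Ftail _) _; apply: le_trans (phi_tail_le _) _ => //.
rewrite ler_pM2l ?addr_gt0 ?invr_gt0 ?phi_gt0//.
by apply: le_phi; rewrite normr_id.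
Qed.

Lemma stein_xf_le x : `|x * stein_f x| <= 1.
Proof.
rewrite mulrA normrM normfV (gtr0_norm (phi_gt0 _)) ler_pdivrMr ?phi_gt0// mul1r normrM.
apply: (@le_trans _ _ (phi `|x|)); last by apply: le_phi; rewrite normr_id.
by apply: le_trans (mills_ineq (normr_ge0 x)); rewrite ler_wpM2l.
Qed.

(** The derivative of [stein_f], as the equation gives it. *)
Definition stein_df x := x * stein_f x + h x - gmean.

Lemma stein_df_le x : `|stein_df x| <= 2.
Proof.
have := stein_xf_le x; rewrite /stein_df !ler_norml.
by case/andP: (h01 x); case/andP: H01; lra.
Qed.

Lemma is_derive_stein (x : R) : is_derive x 1 (stein_f : R -> R) (stein_df x).
Proof.
have [dF FE] : derivable F x 1 /\ F^`()%classic x = k x.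
  apply: (@continuous_FTC1 R k -oo%O x (x + 1)) => //.
  - by rewrite ltrDl.
  - exact: k_int.
  - exact: ltNyr.
  - apply: cvgM; last exact: continuous_phi.
    by apply: cvgB; [exact: ch|exact: cvg_cst].
have DE : 'D_1 F x = k x by rewrite -derive1E FE.
have DF : is_derive x 1 F (k x) := DeriveDef dF DE.
have p0 : phi x != 0 by rewrite gt_eqF// phi_gt0.
have DV : is_derive x 1 (fun y => (phi y)^-1) (x / phi x).
  have dp := is_derive_phi x.
  have dp1 : derivable (phi : R -> R) x 1 by case: dp.
  apply: DeriveDef; first exact: derivableV.
  rewrite deriveV//.
  rewrite derive_val /GRing.scale/=; field.
  exact: p0.
have H := is_deriveM DF DV.
apply: (is_derive_eq H); rewrite /GRing.scale/= /stein_df /stein_f /k; field.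
exact: p0.
Qed.

End stein.
End gaussian.

(** * Moments of sums *)
Section moments.
Context {R : realType}.
Implicit Types l r : probability R R.

Lemma int_quad_dom r (f : R -> R) (C : R) : measurable_fun setT f ->
  (forall x, `|f x| <= C * (1 + x ^+ 2)) ->
  r.-integrable setT (EFin \o (fun x : R => x ^+ 2)) -> r.-integrable setT (EFin \o f).
Proof.
move=> mf fC i2; apply: (int_dom mf fC); apply: intZ; apply: intD => //.
exact: int_cst.
Qed.

Lemma int_id_of_sq r : r.-integrable setT (EFin \o (fun x : R => x ^+ 2)) ->
  r.-integrable setT (EFin \o (fun x : R => x)).
Proof.
apply: (@int_quad_dom r id 1) => // x; rewrite mul1r.
have := sqr_ge0 (`|x| - 1); rewrite -(real_normK (num_real x)); nra.
Qed.

Lemma sum_law_cons r rs : sum_law (r :: rs) = conv (sum_law rs) r.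
Proof. by []. Qed.

Lemma moments_sum_law (I : Type) (rho : I -> probability R R) (s : seq I) :
  (forall i, (rho i).-integrable setT (EFin \o (fun x : R => x ^+ 2))) ->
  (forall i, \int[rho i]_x x = 0) ->
  [/\ (sum_law (map rho s)).-integrable setT (EFin \o (fun x : R => x ^+ 2)),
    \int[sum_law (map rho s)]_x x = 0 &
    \int[sum_law (map rho s)]_x (x ^+ 2) = \sum_(i <- s) \int[rho i]_x (x ^+ 2)].
Proof.
move=> i2 m0; elim: s => [|i s [IH2 IHm IHs]].
  split.
  - apply/integrableP; split; first exact/measurable_EFinP/measurable_funX.
    rewrite integral_dirac//=; last first.
      by apply/measurable_EFinP; apply: measurableT_comp => //; exact: measurable_funX.
    by rewrite diracT mul1e ltry.
  - by rewrite /Rintegral integral_dirac//= mulr0.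
  - rewrite big_nil /Rintegral integral_dirac//=; last exact/measurable_EFinP/measurable_funX.
    by rewrite expr0n mulr0.
rewrite map_cons sum_law_cons.
set l := sum_law _ in IH2 IHm IHs *.
have i1 := int_id_of_sq (i2 i); have li1 := int_id_of_sq IH2.
(* [2 * (1 + u ^+ 2) * (1 + x ^+ 2)] dominates both [u + x] and its square. *)
have la : l.-integrable setT (EFin \o (fun u : R => 2 * (1 + u ^+ 2))).
  by apply: intZ; apply: intD => //; exact: int_cst.
have lb : (rho i).-integrable setT (EFin \o (fun u : R => (1 + u ^+ 2))).
  by apply: intD => //; exact: int_cst.
have b2 (u x : R) : `|(u + x) ^+ 2| <= 2 * (1 + u ^+ 2) * (1 + x ^+ 2).
  rewrite ger0_norm ?sqr_ge0//; have := sqr_ge0 (u - x).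
  have := mulr_ge0 (sqr_ge0 u) (sqr_ge0 x); nra.
have b1 (u x : R) : `|u + x| <= 2 * (1 + u ^+ 2) * (1 + x ^+ 2).
  have := b2 u x; rewrite ger0_norm ?sqr_ge0// ler_norml.
  have := mulr_ge0 (sqr_ge0 u) (sqr_ge0 x); have := sqr_ge0 (u + x - 1).
  have := sqr_ge0 (u + x + 1).
  have := sqr_ge0 (u - x); move=> *; apply/andP; split; nra.
split.
- by apply: (int_conv _ b2 la lb); exact: measurable_funX.
- rewrite (Rint_conv (f := id) _ b1 la lb)//.
  under eq_Rintegral => x _.
    rewrite RintegralD//; last exact: int_cst.
    rewrite IHm add0r Rint_cst; over.
  exact: m0.
- rewrite big_cons (Rint_conv _ b2 la lb)//.
  rewrite addrC -IHs.
  transitivity (\int[rho i]_x (\int[l]_x x ^+ 2 + x ^+ 2)); last first.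
    by rewrite (RintD (int_cst _ _) (i2 i)) Rint_cst.
  apply: eq_Rintegral => x _.
  transitivity (\int[l]_u (u ^+ 2 + ((2 * x) * u + x ^+ 2))).
    by apply: eq_Rintegral => u _; ring.
  have cx := int_cst l (x ^+ 2).
  rewrite (RintD IH2 (intD (intZ _ li1) cx)) (RintD (intZ _ li1) cx).
  by rewrite (RintZ _ li1) IHm mulr0 add0r Rint_cst.
Qed.
End moments.

(** * The normal distribution function and ramps *)
Section ramp.
Context {R : realType}.
Notation leb := (@lebesgue_measure R).
Notation phi := (@normal_pdf R 0 1).

Lemma int_cst_itv (a b c : R) : leb.-integrable `]a, b] (EFin \o fun=> c).
Proof.
apply/integrableP; split; first exact/measurable_EFinP.
rewrite integral_cst//= lebesgue_measure_itv/=; case: ifPn => _.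
  by rewrite -EFinD -EFinM ltry.
by rewrite mule0 ltry.
Qed.

Lemma Rint_cst_itv (a b c : R) : a <= b -> \int[leb]_(u in `]a, b]) c = (b - a) * c.
Proof.
move=> ab; rewrite Rintegral_cst//= lebesgue_measure_itv/= lte_fin mulrC.
by case: ltP => //= ba; have -> : a = b; [lra|rewrite subrr].
Qed.

Definition Phi (t : R) : R := \int[leb]_(u in `]-oo, t]) phi u.

Lemma Phi_itv (a b : R) : a <= b ->
  Phi b - Phi a = \int[leb]_(u in `]a, b]) phi u.
Proof.
move=> ab; rewrite /Phi (@Rintegral_itvB R phi -oo%O (BRight b) a)//.
exact: integrable_phi.
Qed.

Lemma Phi_increment (a b : R) : a <= b -> 0 <= Phi b - Phi a <= b - a.
Proof.
move=> ab; rewrite Phi_itv//; apply/andP; split.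
  by apply: Rintegral_ge0 => u _; rewrite ltW// phi_gt0.
apply: (@le_trans _ _ (\int[leb]_(u in `]a, b]) 1)).
  apply: le_Rintegral => //; first exact: integrable_phi.
    exact: int_cst_itv.
  by move=> u _; exact: phi_le1.
by rewrite Rint_cst_itv// mulr1.
Qed.

Lemma Phi_increment_ge (a b K : R) : a <= b -> - K <= a -> b <= K ->
  (b - a) * phi K <= Phi b - Phi a.
Proof.
move=> ab aK bK; rewrite Phi_itv//.
apply: (@le_trans _ _ (\int[leb]_(u in `]a, b]) (phi K))).
  by rewrite Rint_cst_itv.
apply: le_Rintegral => //; [exact: int_cst_itv|exact: integrable_phi|].
move=> u /=; rewrite in_itv/= => /andP[au ub]; apply: le_phi.
rewrite (@ger0_norm _ K) ?ler_norml; lra.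
Qed.

(** A Lipschitz substitute for the indicator of []-oo, t]]: it equals 1 up to [t]
    and 0 from [t + la] on, with slope [- la^-1] in between. *)
Definition ramp (t la x : R) : R := Num.min 1 (Num.max 0 ((t + la - x) / la)).

Lemma ramp01 t la x : 0 <= ramp t la x <= 1.
Proof. rewrite /ramp /Order.max; case: ltP => ?; rewrite /Order.min; case: ltP => ?; lra. Qed.

Lemma continuous_ramp t la : continuous (ramp t la).
Proof.
have c0 : continuous (fun x => (t + la - x) / la).
  move=> x; apply: cvgM; last exact: cvg_cst.
  by apply: cvgB; [exact: cvg_cst|exact: cvg_id].
move=> x; apply: (@continuous_min _ _ (cst 1) (fun x => Num.max 0 ((t + la - x) / la))).
  exact: cst_continuous.
apply: (@continuous_max _ _ (cst 0) (fun x => (t + la - x) / la)); last exact: c0.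
exact: cst_continuous.
Qed.

Section rampl.
Variables (t la : R).
Hypothesis la0 : 0 < la.

Lemma ramp1 x : x <= t -> ramp t la x = 1.
Proof.
move=> xt; have : 1 <= (t + la - x) / la by rewrite ler_pdivlMr//; lra.
rewrite /ramp /Order.max; case: ltP => ?; rewrite /Order.min; case: ltP => ? ?; lra.
Qed.

Lemma ramp0 x : t + la <= x -> ramp t la x = 0.
Proof.
move=> xt; have : (t + la - x) / la <= 0 by rewrite ler_pdivrMr//; lra.
rewrite /ramp /Order.max; case: ltP => ?; rewrite /Order.min; case: ltP => ? ?; lra.
Qed.

Lemma ramp_lip x y : `|ramp t la (x + y) - ramp t la x| <= `|y| / la.
Proof.
have -> : `|y| / la = `|y / la| by rewrite normrM normfV (gtr0_norm la0).
have E : (t + la - (x + y)) / la = (t + la - x) / la - y / la by field; rewrite gt_eqF.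
rewrite /ramp E; set a := _ / la; set b := y / la.
have := ler_norm b; have := ler_norm (- b); rewrite normrN.
rewrite ler_norml /Order.max; case: ltP => ?; case: ltP => ?; rewrite /Order.min;
  by case: ltP => ?; case: ltP => ? ? ?; apply/andP; split; lra.
Qed.

(** The two values agree unless the segment from [x] to [x + y] meets the slope. *)
Lemma ramp_supp x y :
  `|ramp t la (x + y) - ramp t la x| <= `|y| / la * \1_`]t - `|y|, t + la + `|y|] x.
Proof.
rewrite indicE; have := ler_norm y; have := ler_norm (- y); rewrite normrN => y1 y2.
case: (boolP (x \in _)) => [_|]; first by rewrite mulr1 ramp_lip.
rewrite notin_setE /= in_itv/= => /negP; rewrite negb_and -leNgt -ltNge.
rewrite mulr0 => /orP[H|H].
  by rewrite !ramp1 ?subrr ?normr0//; lra.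
by rewrite !ramp0 ?subrr ?normr0//; lra.
Qed.

Lemma gmean_ramp : Phi t <= gmean (ramp t la) <= Phi (t + la).
Proof.
have pr t' : leb.-integrable setT (EFin \o (phi \_ `]-oo, t'])).
  rewrite -restrict_EFin; apply/integrable_restrict => //; rewrite setTI; exact: integrable_phi.
have hi : leb.-integrable setT (EFin \o (fun u => ramp t la u * phi u)).
  exact: (gmean_int (@continuous_ramp t la) (ramp01 t la) measurableT).
have PhiE t' : Phi t' = \int[leb]_u ((phi \_ `]-oo, t']) u).
  by rewrite /Phi Rintegral_mkcond.
rewrite !PhiE /gmean; apply/andP; split.
  apply: le_Rintegral => // u _; rewrite patchE; case: ifPn => [|_].
    by rewrite inE/= in_itv/= => ut; rewrite ramp1// mul1r.
  by rewrite mulr_ge0//; [case/andP: (ramp01 t la u)|rewrite ltW// phi_gt0].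
apply: le_Rintegral => // u _; rewrite patchE; case: ifPn => [_|].
  by rewrite ler_piMl ?(ltW (phi_gt0 _))//; case/andP: (ramp01 t la u).
by rewrite notin_setE/= in_itv/= => /negP; rewrite -ltNge => ut; rewrite ramp0 ?mul0r// ltW.
Qed.
End rampl.
End ramp.

(** * Sums of identically distributed variables *)
Section iid.
Context {R : realType}.
Variable rho : probability R R.
Hypothesis i4 : rho.-integrable setT (EFin \o (fun x : R => x ^+ 4)).
Hypothesis m0 : \int[rho]_x x = 0.
Hypothesis m1 : \int[rho]_x (x ^+ 2) = 1.

Definition iid_sum n : probability R R := sum_law (map (fun=> rho) (iota 0 n)).

Lemma iid_sumS n : iid_sum n.+1 = conv (iid_sum n) rho.
Proof.
rewrite /iid_sum; have -> : iota 0 n.+1 = 0%N :: iota 1 n by [].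
rewrite map_cons sum_law_cons; congr conv; congr sum_law.
by rewrite (iotaDl 1 0 n) -map_comp.
Qed.

Lemma int_quartic_dom (f : R -> R) (C : R) : measurable_fun setT f ->
  (forall x, `|f x| <= C * (1 + x ^+ 4)) -> rho.-integrable setT (EFin \o f).
Proof.
move=> mf fC; apply: (int_dom mf fC); apply: intZ; apply: intD => //.
exact: int_cst.
Qed.

Lemma int_sq : rho.-integrable setT (EFin \o (fun x : R => x ^+ 2)).
Proof.
apply: (int_quartic_dom (C := 1)) => // x; rewrite ger0_norm ?sqr_ge0//.
have -> : x ^+ 4 = (x ^+ 2) ^+ 2 by rewrite -exprM.
have := sqr_ge0 (x ^+ 2 - 1); nra.
Qed.

Lemma int_id : rho.-integrable setT (EFin \o (fun x : R => x)).
Proof. exact: int_id_of_sq int_sq. Qed.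

Lemma iid_sum_moments n :
  [/\ (iid_sum n).-integrable setT (EFin \o (fun x : R => x ^+ 2)),
    \int[iid_sum n]_x x = 0 & \int[iid_sum n]_x (x ^+ 2) = n%:R].
Proof.
have [a b c] := moments_sum_law (iota 0 n) (fun=> int_sq) (fun=> m0).
split => //; rewrite /iid_sum c (eq_bigr (fun=> 1)) => [|i _]; last exact: m1.
by rewrite big_const_seq count_predT size_iota iter_addr_0.
Qed.

Lemma integrable_iid_sum n : (iid_sum n).-integrable setT (EFin \o (fun x : R => x)).
Proof. by apply: int_id_of_sq; case: (iid_sum_moments n). Qed.

Section bounded.
Variables (g : R -> R) (M : R).
Hypothesis mg : measurable_fun setT g.
Hypothesis gM : forall x, `|g x| <= M.

Lemma bound_ge0 : 0 <= M. Proof. exact: le_trans (normr_ge0 _) (gM 0). Qed.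

Lemma shift_meas x : measurable_fun setT (fun u : R => g (u + x)).
Proof. by apply: measurableT_comp => //; exact: measurable_funD. Qed.

Lemma shift_int n x : (iid_sum n).-integrable setT (EFin \o (fun u : R => g (u + x))).
Proof. exact: (int_bounded _ (shift_meas x) (fun u => gM (u + x))). Qed.

Definition shift_mean n x := \int[iid_sum n]_u g (u + x).

Lemma shift_mean_le n x : `|shift_mean n x| <= M.
Proof.
rewrite -(Rint_cst (iid_sum n) M); apply: Rint_norm_le => //; first exact: shift_int.
exact: int_cst.
Qed.

Let mgp : measurable_fun setT (fun p : R * R => g (p.1 + p.2)).
Proof. by apply: measurableT_comp => //; exact: measurable_addp. Qed.

Lemma measurable_shift_mean n : measurable_fun setT (shift_mean n).
Proof.
apply: (int_meas (mu := rho)).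
apply: (int_marginal2 (F := fun p : R * R => g (p.1 + p.2)) (a := cst M) (b := cst 1)) => //.
- by move=> u x; rewrite /= mulr1.
- exact: int_cst.
- exact: int_cst.
Qed.

Lemma Rint_lamS n : \int[iid_sum n.+1]_s g s = \int[rho]_x shift_mean n x.
Proof.
rewrite iid_sumS; apply: (Rint_conv (a := cst M) (b := cst 1)) => //.
- by move=> u x; rewrite /= mulr1.
- exact: int_cst.
- exact: int_cst.
Qed.

Lemma shift_meanS n x : shift_mean n.+1 x = \int[rho]_y shift_mean n (y + x).
Proof.
have gb u y : `|g (u + y + x)| <= cst M u * cst 1 y by rewrite /= mulr1.
rewrite [LHS]/shift_mean iid_sumS.
rewrite (Rint_conv (shift_meas x) gb (int_cst _ M) (int_cst _ 1)).
by apply: eq_Rintegral => y _; apply: eq_Rintegral => u _; rewrite addrA.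
Qed.

Lemma absid_int (r : probability R R) : r.-integrable setT (EFin \o (fun x : R => x)) ->
  r.-integrable setT (EFin \o (fun x : R => 1 + `|x|)).
Proof. by move=> i; apply: intD (int_cst _ _) (int_norm i). Qed.

(** [S * g S] is split according to [S = U + X], with [X] the last summand. *)
Lemma Rint_split n : \int[iid_sum n.+1]_s (s * g s) =
  \int[rho]_x \int[iid_sum n]_u (u * g (u + x)) + \int[rho]_x (x * shift_mean n x).
Proof.
have M0 := bound_ge0.
have mid : measurable_fun setT (fun s : R => s * g s) by exact: measurable_funM.
have li := absid_int (integrable_iid_sum n); have ri := absid_int int_id.
have lM : (iid_sum n).-integrable setT (EFin \o (fun x : R => M * (1 + `|x|))) by exact: intZ.
have gb u x : `|(u + x) * g (u + x)| <= M * (1 + `|u|) * (1 + `|x|).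
  rewrite normrM mulrC -mulrA; apply: ler_pM => //.
  apply: le_trans (ler_normD _ _) _.
  have := mulr_ge0 (normr_ge0 u) (normr_ge0 x); lra.
rewrite iid_sumS (Rint_conv mid gb lM ri).
have i_x : rho.-integrable setT (EFin \o (fun x : R => \int[iid_sum n]_u (u * g (u + x)))).
  apply: (int_marginal2 (F := fun p : R * R => p.1 * g (p.1 + p.2))
    (a := fun u : R => M * (1 + `|u|)) (b := cst 1)) => //.
  - exact: measurable_funM.
  - move=> u x; rewrite /= mulr1 normrM mulrC; apply: ler_pM => //; lra.
  - exact: int_cst.
have i_y : rho.-integrable setT (EFin \o (fun x : R => x * shift_mean n x)).
  apply: (int_dom (g := fun x : R => M * `|x|)).
  - apply: measurable_funM => //; exact: measurable_shift_mean.
  - by move=> x; rewrite normrM mulrC; apply: ler_pM => //; exact: shift_mean_le.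
  - by apply: intZ; exact: int_norm int_id.
rewrite -(RintD i_x i_y); apply: eq_Rintegral => x _.
have iu : (iid_sum n).-integrable setT (EFin \o (fun u : R => u * g (u + x))).
  apply: (int_dom (g := fun u : R => M * `|u|)).
  - apply: measurable_funM => //; exact: shift_meas.
  - by move=> u; rewrite normrM mulrC; apply: ler_pM.
  - by apply: intZ; exact: int_norm (integrable_iid_sum n).
rewrite -(RintZ x (shift_int n x)) -(RintD iu (intZ x (shift_int n x))).
by apply: eq_Rintegral => u _; rewrite mulrDl.
Qed.

End bounded.

Lemma Rint_dirac0 (f : R -> R) : measurable_fun setT f -> \int[iid_sum 0]_x f x = f 0.
Proof.
move=> mf; rewrite /iid_sum /Rintegral /= integral_dirac//=; last exact/measurable_EFinP.
by rewrite indicT mul1r.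
Qed.

(** By symmetry each of the [n + 1] summands [X] contributes the same amount
    [E (X * g (U + X))] to [E (S * g S)], with [U] the sum of the other ones.  On
    iterated convolutions this is an induction: the last summand [X] contributes
    its share directly, the induction hypothesis for the translate of [g] by [X]
    gives the other [n] shares, and swapping two integrations makes them equal
    to it. *)
Lemma Rint_iid_sum_exchange n (g : R -> R) (M : R) :
  measurable_fun setT g -> (forall x, `|g x| <= M) ->
  \int[iid_sum n.+1]_s (s * g s) = n.+1%:R * \int[rho]_x (x * shift_mean g n x).
Proof.
elim: n g => [|n IH] g mg gM; rewrite (Rint_split mg gM).
  rewrite mul1r [X in X + _](_ : _ = 0) ?add0r//.
  rewrite -[RHS](Rint_cst rho); apply: eq_Rintegral => x _.
  rewrite Rint_dirac0 ?mul0r//; apply: measurable_funM => //; exact: shift_meas.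
rewrite -[in RHS]natr1 mulrDl mul1r; congr (_ + _).
transitivity (\int[rho]_x (n.+1%:R * \int[rho]_y (y * shift_mean g n (y + x)))).
  apply: eq_Rintegral => x _.
  rewrite (IH _ (shift_meas mg x) (fun u => gM (u + x))); congr (_ * _).
  apply: eq_Rintegral => y _; congr (_ * _).
  by rewrite /shift_mean; under eq_Rintegral do rewrite -addrA.
have mF : measurable_fun setT (fun p : R * R => p.2 * shift_mean g n (p.2 + p.1)).
  apply: measurable_funM => //; apply: (measurableT_comp (measurable_shift_mean mg gM n)).
  exact: measurable_funD.
have Fb x y : `|y * shift_mean g n (y + x)| <= M * `|y|.
  by rewrite normrM mulrC; apply: ler_pM => //; exact: shift_mean_le.
have ri : rho.-integrable setT (EFin \o (fun y : R => `|y|)) by exact: int_norm int_id.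
rewrite RintZ; last first.
  exact: (int_marginal1 (F := fun p : R * R => p.2 * shift_mean g n (p.2 + p.1))
    mF Fb (int_cst rho M) ri).
congr (_ * _).
rewrite (Rint_exchange (F := fun p : R * R => p.2 * shift_mean g n (p.2 + p.1))
  mF Fb (int_cst rho M) ri)/=.
apply: eq_Rintegral => y _.
have iy : rho.-integrable setT (EFin \o (fun x : R => shift_mean g n (y + x))).
  apply: (int_bounded _ _ (fun x => shift_mean_le mg gM n (y + x))).
  by apply: (measurableT_comp (measurable_shift_mean mg gM n)); exact: measurable_funD.
rewrite (RintZ _ iy) (shift_meanS mg gM); congr (_ * _).
by apply: eq_Rintegral => x _; rewrite addrC.
Qed.
End iid.

(** * Stein's solution for a ramp *)
Section stein_bounds.
Context {R : realType}.
Notation tail_const := (@tail_const R).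

Lemma mvt_shift (f df : R -> R) : (forall x : R, is_derive x 1 f (df x)) ->
  forall v y, exists2 y', `|y'| <= `|y| & f (v + y) - f v = y * df (v + y').
Proof.
move=> fd v y.
have fc : continuous f.
  move=> x; apply/differentiable_continuous/derivable1_diffP.
  by case: (fd x).
have [y0|y0] := leP 0 y.
  have vy : v <= v + y by lra.
  have [c] := MVT_segment vy (fun x _ => fd x) (continuous_subspaceT fc).
  rewrite in_itv/= => /andP[c1 c2] ->; exists (c - v).
    by rewrite !ger0_norm//; lra.
  have -> : v + (c - v) = c by lra.
  by lra.
have vy : v + y <= v by lra.
have [c] := MVT_segment vy (fun x _ => fd x) (continuous_subspaceT fc).
rewrite in_itv/= => /andP[c1 c2] E; exists (c - v).
  by rewrite !ler0_norm//; lra.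
have -> : v + (c - v) = c by lra.
by rewrite -[LHS]opprB E; lra.
Qed.

Variables (t la : R).
Hypothesis la0 : 0 < la.
Let h := ramp t la.
Let ch : continuous h := @continuous_ramp R t la.
Let h01 : forall x, 0 <= h x <= 1 := @ramp01 R t la.
Let f := stein_f h.
Let df := stein_df h.

(** A bound for the change of [f' = x * f + h - gmean] when [v] moves by [y].  The
    first term comes from [x * f]; the second is the change of the ramp, which
    matters only for [v] near its slope. *)
Definition osc (v y : R) : R :=
  `|y| * (tail_const + 2 * `|v|) + `|y| / la * \1_`]t - `|y|, t + la + `|y|] v.

Lemma le_osc v y y' : `|y'| <= `|y| -> osc v y' <= osc v y.
Proof.
move=> yy; have tc : 0 <= tail_const := le_trans (normr_ge0 _) (stein_f_le ch h01 0).
apply: lerD; first by apply: ler_wpM2r => //; rewrite addr_ge0// mulr_ge0.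
apply: ler_pM => //; first by rewrite divr_ge0// ltW.
  by rewrite ler_pM2r ?invr_gt0.
rewrite !indicE ler_nat; case: (boolP (v \in _)) => // H.
suff -> : v \in `]t - `|y|, t + la + `|y|]%classic by [].
move: H; rewrite !inE/= !in_itv/= => /andP[H1 H2]; apply/andP; split; lra.
Qed.

Lemma stein_lip v y : `|f (v + y) - f v| <= 2 * `|y|.
Proof.
have [y' _ ->] := mvt_shift (is_derive_stein ch h01) v y.
rewrite normrM mulrC; apply: ler_wpM2r => //; exact: stein_df_le.
Qed.

Lemma stein_df_osc v y : `|df (v + y) - df v| <= osc v y.
Proof.
have -> : df (v + y) - df v =
    y * f (v + y) + v * (f (v + y) - f v) + (h (v + y) - h v).
  by rewrite /df /stein_df -/f; ring.
apply: le_trans (ler_normD _ _) _; apply: lerD; last exact: ramp_supp.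
rewrite [leRHS]mulrDr; apply: le_trans (ler_normD _ _) _; apply: lerD; rewrite normrM.
  by apply: ler_wpM2l => //; exact: stein_f_le.
apply: le_trans (_ : `|v| * (2 * `|y|) <= _); last lra.
by apply: ler_wpM2l => //; exact: stein_lip.
Qed.

Lemma stein_taylor v y : `|f (v + y) - f v - y * df v| <= `|y| * osc v y.
Proof.
have [y' yy ->] := mvt_shift (is_derive_stein ch h01) v y.
rewrite -mulrBr normrM; apply: ler_wpM2l => //.
exact: le_trans (stein_df_osc _ _) (le_osc _ yy).
Qed.
End stein_bounds.

(** * Stein's identity and the induction step *)
Lemma sqrtS_le (R : realType) n : Num.sqrt n.+2%:R <= 2 * Num.sqrt n.+1%:R :> R.
Proof.
rewrite -(@ler_pXn2r _ 2) ?nnegrE ?mulr_ge0// exprMn !sqr_sqrtr//.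
have n1 : (1 : R) <= n.+1%:R by rewrite ler1n.
by rewrite -[n.+2%:R]natr1; nra.
Qed.

Section stein_step.
Context {R : realType}.
Notation K := (@tail_const R).
Variable rho : probability R R.
Hypothesis i4 : rho.-integrable setT (EFin \o (fun x : R => x ^+ 4)).
Hypothesis m0 : \int[rho]_x x = 0.
Hypothesis m1 : \int[rho]_x (x ^+ 2) = 1.

Variables (n : nat) (t la delta : R).
Hypothesis la0 : 0 < la.
Notation l := (iid_sum rho n.+1).
Let s : R := Num.sqrt n.+2%:R.
Let c : R := Num.sqrt n.+1%:R.
Hypothesis cdf_close : forall r, `|fine (l `]-oo, c * r]%classic) - Phi r| <= delta.

Let s0 : 0 < s. Proof. by rewrite sqrtr_gt0. Qed.
Let c0 : 0 < c. Proof. by rewrite sqrtr_gt0. Qed.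
Let sE : s ^+ 2 = n.+2%:R. Proof. by rewrite sqr_sqrtr. Qed.

Let sc : s <= 2 * c. Proof. exact: sqrtS_le. Qed.

(** The normal law gives an interval at most its length.  The factor 2 covers the
    passage from the scale [c] of the hypothesis on [n.+1] variables to the scale
    [s] of [n.+2] variables. *)
Lemma iid_sum_itv_le a b : a <= b -> fine (l `]a * s, b * s]%classic) <= 2 * (b - a) + 2 * delta.
Proof.
move=> ab.
have E : fine (l `]-oo, b * s]%classic) =
    fine (l `]-oo, a * s]%classic) + fine (l `]a * s, b * s]%classic).
  rewrite -fineD ?fin_num_measure// -measureU//.
    congr (fine (l _)); apply/seteqP; split => x /=; rewrite !in_itv/=.
      by move=> xb; case: (leP x (a * s)); [left|right].
    by case=> [xa|/andP[]//]; apply: le_trans xa _; rewrite ler_pM2r.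
  apply/seteqP; split => x //= []; rewrite !in_itv/= => xa /andP[].
  by rewrite ltNge xa.
have cK z : z * s = c * (z * s / c) by field; rewrite gt_eqF.
have := cdf_close (a * s / c); have := cdf_close (b * s / c); rewrite -!cK !ler_norml.
have abc : a * s / c <= b * s / c by rewrite ler_pM2r ?invr_gt0// ler_pM2r.
have /andP[_] := Phi_increment abc.
have : b * s / c - a * s / c <= 2 * (b - a).
  rewrite -mulrBl -mulrBl -mulrA mulrC ler_wpM2r ?subr_ge0//.
  by rewrite ler_pdivrMr.
by move=> ? ? /andP[? ?] /andP[? ?]; lra.
Qed.

Let lsq : l.-integrable setT (EFin \o (fun u : R => u ^+ 2)).
Proof. by case: (iid_sum_moments i4 m0 m1 n.+1). Qed.

Let abs_s_int : l.-integrable setT (EFin \o (fun u : R => `|u / s|)).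
Proof.
apply: int_norm; have := intZ s^-1 (integrable_iid_sum i4 m0 m1 n.+1).
by apply: eq_integrable => // u _ /=; rewrite mulrC.
Qed.

(* [2 * |t| <= 1 + t ^+ 2], and the second moment of [u / s] is below 1. *)
Let abs_s_le : \int[l]_u (2 * `|u / s|) <= 2.
Proof.
have i : l.-integrable setT (EFin \o (fun u : R => 1 + s ^- 2 * u ^+ 2)).
  by apply: intD; [exact: int_cst|exact: intZ].
apply: (@le_trans _ _ (\int[l]_u (1 + s ^- 2 * u ^+ 2))).
  apply: le_Rint => //; first exact: intZ.
  move=> u; have -> : s ^- 2 * u ^+ 2 = `|u / s| ^+ 2.
    by rewrite real_normK ?num_real// exprMn exprVn mulrC.
  have := sqr_ge0 (`|u / s| - 1); nra.
rewrite (RintD (int_cst _ _) (intZ _ lsq)) (RintZ _ lsq) Rint_cst.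
have [_ _ ->] := iid_sum_moments i4 m0 m1 n.+1.
have : s ^- 2 * n.+1%:R <= 1.
  by rewrite sE mulrC ler_pdivrMr ?ltr0n// mul1r ler_nat.
by move=> H; exact: (lerD (lexx 1) H).
Qed.

Let indE (y u : R) : \1_`]t - `|y|, t + la + `|y|] (u / s) =
   \1_`](t - `|y|) * s, (t + la + `|y|) * s] u :> R.
Proof.
rewrite !indicE; congr (nat_of_bool _)%:R; apply/idP/idP; rewrite !inE/= !in_itv/=.
  by rewrite ltr_pdivlMr// ler_pdivrMr.
by rewrite ltr_pdivlMr// ler_pdivrMr.
Qed.

Let osc_split (y a u : R) : a = `|y| -> osc t la (u / s) y = a * K + (a * (2 * `|u / s|) +
   a / la * \1_`](t - a) * s, (t + la + a) * s] u).
Proof. by move=> ->; rewrite /osc indE; ring. Qed.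

Lemma int_osc y : l.-integrable setT (EFin \o (fun u : R => osc t la (u / s) y)).
Proof.
have : l.-integrable setT (EFin \o (fun u : R => `|y| * K + (`|y| * (2 * `|u / s|) +
   `|y| / la * \1_`](t - `|y|) * s, (t + la + `|y|) * s] u))).
  apply: intD; first exact: int_cst.
  by apply: intD; apply: intZ; [exact: intZ|exact: int_indic].
by apply: eq_integrable => // u _ /=; rewrite (osc_split _ erefl).
Qed.

(** A sum of [n.+1] variables is near the slope of the ramp with probability of
    order [la + a + delta]: this is where closeness to the normal law for
    [n.+1] variables serves in the step to [n.+2]. *)
Lemma Rint_osc_le (y a : R) : a = `|y| -> \int[l]_u (osc t la (u / s) y) <=
  a * (K + 4 + 2 * delta / la) + 4 / la * a ^+ 2.
Proof.
move=> ay; have a0 : 0 <= a by rewrite ay.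
have la0' := la0.
under eq_Rintegral do rewrite (osc_split _ ay).
set I := `](t - a) * s, _]%classic.
have mI : measurable I by exact: measurable_itv.
have iI := int_indic l mI.
have i2 : l.-integrable setT (EFin \o (fun u : R => 2 * `|u / s|)) by exact: intZ.
have -> : \int[l]_x (a * K + (a * (2 * `|x / s|) + a / la * \1_I x)) =
    a * K + (a * \int[l]_x (2 * `|x / s|) + a / la * fine (l I)).
  rewrite (RintD (int_cst _ _) (intD (intZ _ i2) (intZ _ iI))).
  by rewrite (RintD (intZ _ i2) (intZ _ iI)) (RintZ _ i2) (RintZ _ iI) Rint_cst Rint_indic.
have ab : t - a <= t + la + a by lra.
have H : fine (l I) <= 2 * (la + 2 * a) + 2 * delta.
  by apply: le_trans (iid_sum_itv_le ab) _; lra.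
have H1 : a * \int[l]_x (2 * `|x / s|) <= a * 2 by apply: ler_wpM2l.
have H3 : a / la * fine (l I) <= a / la * (2 * (la + 2 * a) + 2 * delta).
  by apply: ler_wpM2l => //; rewrite divr_ge0// ltW.
have E : a / la * (2 * (la + 2 * a) + 2 * delta) =
   a * 2 + 4 / la * a ^+ 2 + a * (2 * delta / la).
  by field; rewrite gt_eqF.
lra.
Qed.

End stein_step.

Section stein_error.
Context {R : realType}.
Notation K := (@tail_const R).
Variable rho : probability R R.
Hypothesis i4 : rho.-integrable setT (EFin \o (fun x : R => x ^+ 4)).
Hypothesis m0 : \int[rho]_x x = 0.
Hypothesis m1 : \int[rho]_x (x ^+ 2) = 1.

(** The errors of the two terms of Stein's identity carry the weights [1] and
    [x ^+ 2]; multiplied by the [|x|] and [x ^+ 2] of [Rint_osc_le], they sum up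
    to these moments. *)
Definition mom3 := \int[rho]_x ((1 + x ^+ 2) * `|x|).
Definition mom4 := \int[rho]_x ((1 + x ^+ 2) * x ^+ 2).

Lemma int_mom3 : rho.-integrable setT (EFin \o (fun x : R => (1 + x ^+ 2) * `|x|)).
Proof.
apply: (int_quartic_dom (C := 4) i4).
  by apply: measurable_funM => //; apply: measurable_funD.
move=> x; rewrite normrM normr_id ger0_norm ?addr_ge0 ?sqr_ge0//.
have -> : x ^+ 4 = (`|x| ^+ 2) ^+ 2 by rewrite real_normK ?num_real// -exprM.
rewrite -[x ^+ 2](real_normK (num_real x)).
have : 0 <= `|x| by []. set a := `|x| => a0.
have := sqr_ge0 (a ^+ 2 - a); have := sqr_ge0 (a - 1); have := sqr_ge0 (a ^+ 2 - 1); nra.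
Qed.

Lemma int_mom4 : rho.-integrable setT (EFin \o (fun x : R => (1 + x ^+ 2) * x ^+ 2)).
Proof.
apply: (int_quartic_dom (C := 4) i4).
  by apply: measurable_funM => //; apply: measurable_funD.
move=> x; rewrite ger0_norm; last by rewrite mulr_ge0 ?addr_ge0 ?sqr_ge0.
have -> : x ^+ 4 = (x ^+ 2) ^+ 2 by rewrite -exprM.
have := sqr_ge0 (x ^+ 2 - 1); nra.
Qed.

Variables (n : nat) (t la delta : R).
Hypothesis la0 : 0 < la.
Notation l := (iid_sum rho n.+1).
Let s : R := Num.sqrt n.+2%:R.
Let c : R := Num.sqrt n.+1%:R.
Hypothesis cdf_close : forall r, `|fine (l `]-oo, c * r]%classic) - Phi r| <= delta.

Let s0 : 0 < s. Proof. by rewrite sqrtr_gt0. Qed.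
Let sE : s ^+ 2 = n.+2%:R. Proof. by rewrite sqr_sqrtr. Qed.

Let h := ramp t la.
Let ch : continuous h := @continuous_ramp R t la.
Let h01 : forall x, 0 <= h x <= 1 := @ramp01 R t la.
Let f : R -> R := stein_f h.
Let df : R -> R := stein_df h.
Let g (u : R) : R := f (u / s).
Let gd (u : R) : R := df (u / s).

Let mdiv : measurable_fun setT (fun u : R => u / s).
Proof. by apply: measurable_funM. Qed.

Let mf : measurable_fun setT f.
Proof.
apply: continuous_measurable_fun => x.
apply/differentiable_continuous/derivable1_diffP.
by case: (is_derive_stein ch h01 x).
Qed.

Let mg : measurable_fun setT g. Proof. exact: (measurableT_comp mf mdiv). Qed.

Let mh : measurable_fun setT h. Proof. exact: continuous_measurable_fun. Qed.

Let mgd : measurable_fun setT gd.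
Proof.
apply: (measurableT_comp _ mdiv); apply: measurable_funB => //.
by apply: measurable_funD => //; apply: measurable_funM.
Qed.

Let gK u : `|g u| <= K. Proof. exact: stein_f_le. Qed.
Let gd2 u : `|gd u| <= 2. Proof. exact: stein_df_le. Qed.

Let mhs : measurable_fun setT (fun S : R => h (S / s)).
Proof. exact: (measurableT_comp mh mdiv). Qed.

Let sg_int : (iid_sum rho n.+2).-integrable setT (EFin \o (fun S : R => s^-1 * (S * g S))).
Proof.
apply: intZ; apply: (int_dom (g := fun S : R => K * `|S|)).
- by apply: measurable_funM.
- by move=> S; rewrite normrM mulrC; apply: ler_wpM2r.
- by apply: intZ; apply: int_norm; exact: integrable_iid_sum.
Qed.

Let i_gd : rho.-integrable setT (EFin \o shift_mean rho gd n.+1).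
Proof.
exact: (int_bounded _ (measurable_shift_mean _ mgd gd2 n.+1) (shift_mean_le _ mgd gd2 n.+1)).
Qed.

Let i_g : rho.-integrable setT (EFin \o (fun x : R => x * shift_mean rho g n.+1 x)).
Proof.
apply: (int_dom (g := fun x : R => K * `|x|)).
- by apply: measurable_funM => //; exact: (measurable_shift_mean _ mg gK).
- by move=> x; rewrite normrM mulrC; apply: ler_wpM2r => //; exact: (shift_mean_le _ mg gK).
- by apply: intZ; apply: int_norm; exact: int_id.
Qed.

(** Stein's equation at [S / s] writes the left-hand side as the expectation of
    [f' (S / s) - S / s * f (S / s)]; the last summand [x] is split off from the
    first term, and exchangeability turns the second one into [n.+2 = s ^+ 2]
    copies of the same integral. *)
Lemma stein_identity : \int[iid_sum rho n.+2]_S h (S / s) - gmean h =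
  \int[rho]_x (shift_mean rho gd n.+1 x - s * (x * shift_mean rho g n.+1 x)).
Proof.
have hi : (iid_sum rho n.+2).-integrable setT (EFin \o (fun S : R => h (S / s))).
  have hs1 (S : R) : `|h (S / s)| <= 1.
    by rewrite ger0_norm; case/andP: (h01 (S / s)).
  exact: (int_bounded _ mhs hs1).
have gdi : (iid_sum rho n.+2).-integrable setT (EFin \o gd) by exact: (int_bounded _ mgd gd2).
transitivity (\int[iid_sum rho n.+2]_S (gd S - s^-1 * (S * g S))).
  rewrite -[X in _ - X](Rint_cst (iid_sum rho n.+2)) -(RintB hi (int_cst _ (gmean h))).
  apply: eq_Rintegral => S _; rewrite /= /gd /df /stein_df /g /f; ring.
have sg : (iid_sum rho n.+2).-integrable setT (EFin \o (fun S : R => S * g S)).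
  have := intZ s sg_int; apply: eq_integrable => // S _ /=.
  by rewrite mulrA divff ?mul1r// gt_eqF.
rewrite (RintB gdi sg_int) (RintZ _ sg) (RintB i_gd (intZ _ i_g)) (RintZ _ i_g).
rewrite (Rint_lamS _ mgd gd2) (Rint_iid_sum_exchange i4 m0 m1 _ mg gK) mulrA -sE.
by congr (_ - _ * _); field; rewrite gt_eqF.
Qed.

(** Expanding [f ((U + x) / s)] around [U / s], the main terms of the identity
    cancel since [x] has mean 0 and variance 1.  What is left are changes of
    [f'] over a step [x / s], which [osc] controls. *)
Lemma stein_error : `|\int[iid_sum rho n.+2]_S h (S / s) - gmean h| <=
  s^-1 * (K + 4 + 2 * delta / la) * mom3 + 4 / la * s ^- 2 * mom4.
Proof.
rewrite stein_identity.
set c0 := \int[l]_u g u; set c1 := \int[l]_u gd u.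
have i_1 := int_id i4; have i_2 := int_sq i4.
(* The terms added to the integrand have integral 0 and cancel the main terms of
   the expansion. *)
pose Er x := (shift_mean rho gd n.+1 x - s * (x * shift_mean rho g n.+1 x)) +
  ((s * c0) * x + (c1 * x ^+ 2 - c1)).
have iEr1 := intB i_gd (intZ s i_g).
have iEr2 := intD (intZ (s * c0) i_1) (intB (intZ c1 i_2) (int_cst rho c1)).
have -> : \int[rho]_x (shift_mean rho gd n.+1 x - s * (x * shift_mean rho g n.+1 x)) =
    \int[rho]_x Er x.
  rewrite (RintD iEr1 iEr2) (RintD (intZ (s * c0) i_1) (intB (intZ c1 i_2) (int_cst rho c1))).
  rewrite (RintB (intZ c1 i_2) (int_cst rho c1)) (RintZ _ i_1) (RintZ _ i_2) Rint_cst m0 m1.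
  by rewrite mulr0 mulr1 subrr !addr0.
have li_g : l.-integrable setT (EFin \o g) by exact: (int_bounded _ mg gK).
have li_gd : l.-integrable setT (EFin \o gd) by exact: (int_bounded _ mgd gd2).
have -> : s^-1 * (K + 4 + 2 * delta / la) * mom3 + 4 / la * s ^- 2 * mom4 =
  \int[rho]_x (s^-1 * (K + 4 + 2 * delta / la) * ((1 + x ^+ 2) * `|x|) +
      4 / la * s ^- 2 * ((1 + x ^+ 2) * x ^+ 2)).
  by rewrite (RintD (intZ _ int_mom3) (intZ _ int_mom4)) (RintZ _ int_mom3) (RintZ _ int_mom4).
apply: Rint_norm_le => [||x].
- exact: intD iEr1 iEr2.
- exact: (intD (intZ _ int_mom3) (intZ _ int_mom4)).
set O := \int[l]_u osc t la (u / s) (x / s).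
have iO := int_osc i4 m0 m1 n t la (x / s).
have sx u : (u + x) / s = u / s + x / s by rewrite mulrDl.
have A : `|shift_mean rho gd n.+1 x - c1| <= O.
  rewrite -(RintB (shift_int _ mgd gd2 n.+1 x) li_gd).
  apply: Rint_norm_le => // [|u]; first exact: intB (shift_int _ mgd gd2 n.+1 x) li_gd.
  by rewrite /gd sx; exact: stein_df_osc.
have B : `|shift_mean rho g n.+1 x - c0 - x / s * c1| <= `|x / s| * O.
  have i5 := intB (shift_int _ mg gK n.+1 x) li_g.
  rewrite -(RintB (shift_int _ mg gK n.+1 x) li_g) -(RintZ _ li_gd).
  rewrite -(RintB i5 (intZ _ li_gd)) -(RintZ _ iO).
  apply: Rint_norm_le => // [||u]; [exact: intB i5 (intZ _ li_gd)|exact: intZ|].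
  by rewrite /gd /g sx; exact: stein_taylor.
have -> : Er x = (shift_mean rho gd n.+1 x - c1) -
    s * x * (shift_mean rho g n.+1 x - c0 - x / s * c1).
  by rewrite /Er; field; rewrite gt_eqF.
apply: le_trans (ler_normB _ _) _.
have sx2 : `|s * x| * `|x / s| = x ^+ 2.
  rewrite -normrM (_ : s * x * (x / s) = x ^+ 2); last by field; rewrite gt_eqF.
  by rewrite ger0_norm ?sqr_ge0.
have C : `|s * x * (shift_mean rho g n.+1 x - c0 - x / s * c1)| <= x ^+ 2 * O.
  by rewrite [leLHS]normrM -sx2 -[leRHS]mulrA; apply: ler_wpM2l.
have D : O <= `|x / s| * (K + 4 + 2 * delta / la) + 4 / la * `|x / s| ^+ 2.
  exact: Rint_osc_le.
have xs : `|x / s| = s^-1 * `|x| by rewrite normrM normfV (gtr0_norm s0) mulrC.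
apply: (@le_trans _ _ ((1 + x ^+ 2) * O)).
  by rewrite mulrDl mul1r; exact: lerD A C.
apply: (@le_trans _ _ ((1 + x ^+ 2) *
    (`|x / s| * (K + 4 + 2 * delta / la) + 4 / la * `|x / s| ^+ 2))).
  by apply: ler_wpM2l => //; rewrite addr_ge0// sqr_ge0.
rewrite xs exprMn real_normK ?num_real// exprVn le_eqVlt; apply/orP; left; apply/eqP.
ring.
Qed.
End stein_error.

(** * The Berry-Esseen bound *)
Section berry_esseen.
Context {R : realType}.
Notation K := (@tail_const R).
Variable rho : probability R R.
Hypothesis i4 : rho.-integrable setT (EFin \o (fun x : R => x ^+ 4)).
Hypothesis m0 : \int[rho]_x x = 0.
Hypothesis m1 : \int[rho]_x (x ^+ 2) = 1.

Let ramp_div_int (t la s : R) n :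
  (iid_sum rho n).-integrable setT (EFin \o (fun S : R => ramp t la (S / s))).
Proof.
have mr : measurable_fun setT (fun S : R => ramp t la (S / s)).
  apply: (measurableT_comp (continuous_measurable_fun (@continuous_ramp R t la))).
  exact: measurable_funM.
have r1 (S : R) : `|ramp t la (S / s)| <= 1.
  by rewrite ger0_norm; case/andP: (ramp01 t la (S / s)).
exact: (int_bounded _ mr r1).
Qed.

Lemma cdf_le_ramp n (s t la : R) : 0 < s -> 0 < la ->
  fine (iid_sum rho n `]-oo, s * t]%classic) <= \int[iid_sum rho n]_S ramp t la (S / s).
Proof.
move=> s0 la0; have mI : measurable (`]-oo, s * t]%classic : set R) by exact: measurable_itv.
rewrite -Rint_indic//; apply: le_Rint => [||S]; [exact: int_indic|exact: ramp_div_int|].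
rewrite indicE; case: (boolP (S \in _)) => [|_].
  by rewrite inE/= in_itv/= => St; rewrite ramp1// ler_pdivrMr// mulrC.
by case/andP: (ramp01 t la (S / s)).
Qed.

Lemma ramp_le_cdf n (s t la : R) : 0 < s -> 0 < la ->
  \int[iid_sum rho n]_S ramp (t - la) la (S / s) <= fine (iid_sum rho n `]-oo, s * t]%classic).
Proof.
move=> s0 la0; have mI : measurable (`]-oo, s * t]%classic : set R) by exact: measurable_itv.
rewrite -Rint_indic//; apply: le_Rint => [||S]; [exact: ramp_div_int|exact: int_indic|].
rewrite indicE; case: (boolP (S \in _)) => [_|].
  by case/andP: (ramp01 (t - la) la (S / s)).
rewrite notin_setE/= in_itv/= => /negP; rewrite -ltNge => St.
by rewrite ramp0// subrK ler_pdivlMr// mulrC ltW.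
Qed.

Lemma Phi01 (t : R) : 0 <= Phi t <= 1.
Proof.
apply/andP; split; last exact: Rint_phi_le1.
by apply: Rintegral_ge0 => u _; rewrite ltW// phi_gt0.
Qed.

Lemma mom3_ge0 : 0 <= mom3 rho.
Proof. by apply: Rintegral_ge0 => x _; rewrite mulr_ge0// addr_ge0// sqr_ge0. Qed.

Lemma mom4_ge0 : 0 <= mom4 rho.
Proof. by apply: Rintegral_ge0 => x _; rewrite mulr_ge0// ?addr_ge0// sqr_ge0. Qed.

Lemma tail_const_ge0 : 0 <= K.
Proof. by rewrite /tail_const addr_ge0// invr_ge0 ltW// phi_gt0. Qed.

(** The indicator of a half-line lies between the ramps that end, and that begin,
    at its endpoint; replacing it by them costs [la], as the normal distribution
    function is 1-Lipschitz. *)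
Lemma berry_esseen_step n (delta la : R) : 0 < la ->
  (forall r, `|fine (iid_sum rho n.+1 `]-oo, Num.sqrt n.+1%:R * r]%classic) - Phi r| <= delta) ->
  forall r, `|fine (iid_sum rho n.+2 `]-oo, Num.sqrt n.+2%:R * r]%classic) - Phi r| <=
   (Num.sqrt n.+2%:R)^-1 * (K + 4 + 2 * delta / la) * mom3 rho +
   4 / la * (Num.sqrt n.+2%:R) ^- 2 * mom4 rho + la.
Proof.
move=> la0 cdf_close r.
have s0 : (0 : R) < Num.sqrt n.+2%:R by rewrite sqrtr_gt0.
have E1 := stein_error i4 m0 m1 r la0 cdf_close.
have E2 := stein_error i4 m0 m1 (r - la) la0 cdf_close.
move: E1 E2 (cdf_le_ramp n.+2 r s0 la0) (ramp_le_cdf n.+2 r s0 la0).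
set err := _ + _ * mom4 _; set s := Num.sqrt _ in s0 *.
have /andP[_ g1] := gmean_ramp r la0.
have /andP[g2 _] := gmean_ramp (r - la) la0.
have /andP[_] := @Phi_increment R r (r + la) ltac:(by rewrite lerDl ltW).
have /andP[_] := @Phi_increment R (r - la) r ltac:(by rewrite gerBl ltW).
rewrite !ler_norml => ? ? /andP[? ?] /andP[? ?] ? ?; apply/andP; split; lra.
Qed.

(** Bolthausen's induction.  With [la = cc / s], every term of the step is of order
    [1 / s], including the one that contains [delta], whose coefficient is small
    once [cc] is large compared with the third moment; hence a bound [C / sqrt n]
    reproduces itself. *)
Theorem berry_esseen : exists2 C : R, 0 < C & forall n r,
  `|fine (iid_sum rho n.+1 `]-oo, Num.sqrt n.+1%:R * r]%classic) - Phi r| <=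
    C / Num.sqrt n.+1%:R.
Proof.
have h3 : 0 <= mom3 rho by exact: mom3_ge0.
have h4 : 0 <= mom4 rho by exact: mom4_ge0.
have hK : 0 <= K by exact: tail_const_ge0.
set a := mom3 rho in h3; set b := mom4 rho in h4; set k := K in hK.
(* [cc >= 8 * a] makes the coefficient of the inductive bound at most
   [2 * a / cc * 2 <= 1 / 2]. *)
pose cc := 8 * a + 1; have cc0 : 0 < cc by rewrite /cc; lra.
have bc0 : 0 <= b / cc by rewrite divr_ge0// ltW.
pose C0 := a * (k + 4) + 4 * (b / cc) + cc.
have ak : 0 <= a * (k + 4) by rewrite mulr_ge0//; lra.
exists (2 * C0 + 1); first by rewrite /C0; lra.
elim=> [|n IH] r.
  have /andP[p0 p1] := Phi01 r.
  have l1 : fine (iid_sum rho 1 `]-oo, Num.sqrt 1%:R * r]%classic) <= 1.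
    by rewrite -lee_fin fineK ?fin_num_measure//; exact: probability_le1.
  have l0 : 0 <= fine (iid_sum rho 1 `]-oo, Num.sqrt 1%:R * r]%classic) by exact: fine_ge0.
  apply: (@le_trans _ _ 1); first by rewrite ler_norml; apply/andP; split; lra.
  by rewrite sqrtr1 divr1 /C0; lra.
set s : R := Num.sqrt n.+2%:R; set c : R := Num.sqrt n.+1%:R in IH.
have s0 : 0 < s by rewrite sqrtr_gt0.
have c0 : 0 < c by rewrite sqrtr_gt0.
have sc : s <= 2 * c by exact: sqrtS_le.
have la0 : 0 < cc / s by rewrite divr_gt0.
apply: le_trans (berry_esseen_step la0 IH r) _; rewrite -/s -/a -/b -/k.
set C := 2 * C0 + 1 in IH *.
have -> : s^-1 * (k + 4 + 2 * (C / c) / (cc / s)) * a + 4 / (cc / s) * s ^- 2 * b + cc / s =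
  (C0 + 2 * a / cc * C * (s / c)) / s.
  rewrite /C0; field; rewrite !gt_eqF//.
rewrite ler_pM2r ?invr_gt0//.
have C1 : 0 <= C by rewrite /C /C0; lra.
have q1 : 2 * a / cc <= 4^-1 by rewrite ler_pdivrMr// /cc; lra.
have q0 : 0 <= 2 * a / cc by rewrite divr_ge0 ?mulr_ge0// ltW.
have q2 : s / c <= 2 by rewrite ler_pdivrMr.
have q3 : 0 <= s / c by rewrite divr_ge0// ltW.
have q4 : 2 * a / cc * (s / c) <= 4^-1 * 2 by apply: ler_pM.
have q5 : 2 * a / cc * (s / c) * C <= 4^-1 * 2 * C by apply: ler_wpM2r.
have -> : 2 * a / cc * C * (s / c) = 2 * a / cc * (s / c) * C by rewrite mulrAC.
by rewrite /C in q5 *; lra.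
Qed.
End berry_esseen.

(** * The standard Gaussian law and its quantiles *)
Section gauss.
Context {R : realType}.
Notation leb := (@lebesgue_measure R).
Notation phi := (@normal_pdf R 0 1).

(** The normal law is a measure on an alias of [R] with its own measurable
    structure; its image by the identity is a law on [R]. *)
Definition reR (x : measurableTypeR R) : R := x.

Lemma measurable_reR : measurable_fun setT reR.
Proof. exact: measurable_id. Qed.

HB.instance Definition _ := isMeasurableFun.Build _ _ _ _ reR measurable_reR.

Definition gauss : probability R R :=
  distribution (normal_prob 0 1 : probability (measurableTypeR R) R) reR.

Lemma gaussE (A : set R) : gauss A = (\int[leb]_(x in A) (phi x)%:E)%E.
Proof. by []. Qed.

Lemma ge0_integral_gauss (f : R -> \bar R) : measurable_fun setT f ->
  (forall x, 0 <= f x)%E -> (\int[gauss]_x f x = \int[leb]_x (f x * (phi x)%:E))%E.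
Proof.
move=> mf f0.
have dom : (normal_prob 0 1 : {measure set (measurableTypeR R) -> \bar R}) `<< leb.
  exact: normal_prob_dominates.
transitivity (\int[normal_prob 0 1]_x f x)%E.
  by rewrite /gauss ge0_integral_distribution.
rewrite -(Radon_Nikodym_SigmaFinite.change_of_variables (mu := leb) dom)//.
have fi := Radon_Nikodym_SigmaFinite.f_integrable dom.
apply: ae_eq_integral => //.
- by apply: emeasurable_funM => //; exact: measurable_int fi.
- apply: emeasurable_funM => //; exact: measurable_int (integrable_normal_pdf 0 1).
apply: ae_eqe_mul2l; apply: integral_ae_eq => //.
  exact: measurable_int (integrable_normal_pdf 0 1).
by move=> E _ mE; rewrite -Radon_Nikodym_SigmaFinite.f_integral.
Qed.

(** With [y = 3 / 32 * x ^+ 2] the Gaussian exponent splits as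
    [x ^+ 2 / 2 = 4 * y + x ^+ 2 / 8].  The first part absorbs [x ^+ 8], because
    [y * expR (- y) <= 1], and the second is the exponent of the centred normal
    law of standard deviation 2. *)
Lemma pow8_phi_le (x : R) : x ^+ 8 * phi x <=
  (32 / 3) ^+ 4 * (normal_peak 1 / normal_peak 2) * normal_pdf 0 2 x.
Proof.
have n2 : normal_peak 2 != 0 :> R by rewrite gt_eqF// normal_peak_gt0.
rewrite phiE normal_pdfE// /normal_fun subr0.
set y := 3 / 32 * x ^+ 2.
have y0 : 0 <= y by rewrite /y mulr_ge0 ?sqr_ge0//; lra.
have -> : x ^+ 8 = (32 / 3) ^+ 4 * y ^+ 4 by rewrite /y; field.
have -> : - x ^+ 2 / 2 = - y *+ 4 + - x ^+ 2 / (2 ^+ 2 *+ 2) by rewrite /y; field.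
rewrite expRD -[- y *+ 4]mulr_natl expRM_natl.
have y4 : y ^+ 4 * expR (- y) ^+ 4 <= 1.
  rewrite -exprMn; apply: exprn_ile1; first by rewrite mulr_ge0 ?expR_ge0.
  rewrite expRN ler_pdivrMr ?expR_gt0// mul1r.
  by apply: le_trans (expR_ge1Dx _); lra.
set E := expR (- x ^+ 2 / _).
have -> : (32 / 3) ^+ 4 * y ^+ 4 * (normal_peak 1 * (expR (- y) ^+ 4 * E)) =
  (32 / 3) ^+ 4 * normal_peak 1 * E * (y ^+ 4 * expR (- y) ^+ 4) by ring.
have -> : (32 / 3) ^+ 4 * (normal_peak 1 / normal_peak 2) * (normal_peak 2 * E) =
  (32 / 3) ^+ 4 * normal_peak 1 * E * 1 by field.
apply: ler_wpM2l => //; rewrite mulr_ge0 ?expR_ge0// mulr_ge0 ?normal_peak_ge0//.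
Qed.

Lemma gauss_int8 : gauss.-integrable setT (EFin \o (fun x : R => x ^+ 8)).
Proof.
apply/integrableP; split; first exact/measurable_EFinP/measurable_funX.
rewrite ge0_integral_gauss//; last first.
  by apply/measurable_EFinP; apply: measurableT_comp => //; exact: measurable_funX.
pose C : R := (32 / 3) ^+ 4 * (normal_peak 1 / normal_peak 2).
have /integrableP[_ ] := integrableZl measurableT C (@integrable_normal_pdf R 0 2).
apply: le_lt_trans; apply: ge0_le_integral => //.
- by move=> x _; rewrite mule_ge0// lee_fin ltW// phi_gt0.
- apply: emeasurable_funM => //; last exact: measurable_int (integrable_normal_pdf 0 1).
  by apply/measurable_EFinP; apply: measurableT_comp => //; exact: measurable_funX.
- apply: measurableT_comp => //; apply: emeasurable_funM => //.
  exact: measurable_int (integrable_normal_pdf 0 2).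
move=> x _ /=; rewrite lee_fin ger0_norm ?exprn_even_ge0//.
exact: le_trans (pow8_phi_le x) (ler_norm _).
Qed.

Lemma gauss_int_dom8 (f : R -> R) (C : R) : measurable_fun setT f ->
  (forall x, `|f x| <= C * (1 + x ^+ 8)) -> gauss.-integrable setT (EFin \o f).
Proof.
move=> mf fC; apply: (int_dom mf fC); apply: intZ; apply: intD gauss_int8.
exact: int_cst.
Qed.

Lemma PhiN (x : R) : Phi (- x) = 1 - Phi x.
Proof.
have -> : Phi (- x) = \int[leb]_(u in `[x, +oo[) phi u.
  by rewrite /Phi /Rintegral phi_upper_tail.
have := @Rintegral_itvB R phi -oo%O +oo%O x.
move=> /(_ (integrable_phi (measurable_itv _)) isT isT).
rewrite Rintegral_itv_obnd_cbnd; last exact: integrable_phi.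
rewrite set_itvNyy -/(Phi x) => <-.
by rewrite {1}/Rintegral integral_normal_pdf.
Qed.

Lemma Phi_gt0 (x : R) : 0 < Phi x.
Proof.
have /andP[p0 _] := Phi01 (x - 1).
have x1 : x - 1 <= x by rewrite gerBl.
have := Phi_increment_ge x1 (K := `|x| + 1); have := ler_norm x; have := ler_norm (- x).
rewrite normrN => h1 h2 /(_ ltac:(lra) ltac:(lra)).
have := phi_gt0 (`|x| + 1); lra.
Qed.

Lemma upper_quantile_Phi (a z : R) : upper_quantile a z -> Phi z = 1 - a.
Proof.
rewrite /upper_quantile => H.
have : Phi (- z) = a by rewrite /Phi /Rintegral -phi_upper_tail [X in fine X]H.
by rewrite PhiN; lra.
Qed.

Lemma upper_quantile_gt0 (a z : R) : a < 2^-1 -> upper_quantile a z -> 0 < z.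
Proof.
move=> a2 /upper_quantile_Phi zE; rewrite ltNge; apply/negP => z0.
have zz : z <= - z by lra.
have /andP[+ _] := Phi_increment zz; rewrite PhiN zE; lra.
Qed.

End gauss.

(** * The squared positive part of a shifted Gaussian variable *)
Section distr.
Context (d : measure_display) (T : measurableType d) (R : realType).
Variables (mu : probability T R) (X : {mfun T >-> R}) (f : R -> R).
Hypothesis mf : measurable_fun setT f.
Hypothesis fi : mu.-integrable setT (EFin \o (fun w : T => f (X w))).

Lemma int_distr : (distribution mu X).-integrable setT (EFin \o f).
Proof. by apply: integrable_pushforward => //; exact/measurable_EFinP. Qed.

Lemma Rint_distr : \int[distribution mu X]_x f x = \int[mu]_w f (X w).
Proof.
rewrite /Rintegral integral_distribution//; exact/measurable_EFinP.
Qed.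
End distr.

Section onedim.
Context {R : realType}.

Definition pos2 (x : R) : R := Num.max x 0 ^+ 2.

Lemma measurable_pos2 : measurable_fun setT pos2.
Proof. by apply: measurable_funX; exact: measurable_maxr. Qed.

Lemma pos2_ge0 x : 0 <= pos2 x. Proof. exact: sqr_ge0. Qed.

Lemma pos2_pos x : 0 <= x -> pos2 x = x ^+ 2.
Proof. by move=> x0; rewrite /pos2 max_l. Qed.

Lemma pos2_neg x : x <= 0 -> pos2 x = 0.
Proof. by move=> x0; rewrite /pos2 max_r// expr0n. Qed.

Lemma pos2_le x : pos2 x <= x ^+ 2.
Proof. by case: (leP 0 x) => x0; [rewrite pos2_pos|rewrite pos2_neg ?sqr_ge0// ltW]. Qed.

Lemma pos2_le_pow8 x : pos2 x <= 1 + x ^+ 8.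
Proof.
apply: le_trans (pos2_le x) _.
have -> : x ^+ 8 = (x ^+ 2) ^+ 4 by rewrite -exprM.
have := sqr_ge0 x; set y := x ^+ 2 => y0.
have -> : y ^+ 4 = (y ^+ 2) ^+ 2 by rewrite -exprM.
have := sqr_ge0 (y ^+ 2 - 2^-1); have := sqr_ge0 (y - 1); nra.
Qed.

Lemma gauss_int_pos2 : gauss.-integrable setT (EFin \o pos2).
Proof.
apply: (gauss_int_dom8 (C := 1) measurable_pos2) => x.
by rewrite mul1r ger0_norm ?pos2_ge0// pos2_le_pow8.
Qed.

Lemma gauss_int2 : gauss.-integrable setT (EFin \o (fun x : R => x ^+ 2)).
Proof.
apply: (gauss_int_dom8 (C := 1)) => // x; rewrite mul1r ger0_norm ?sqr_ge0//.
have -> : x ^+ 8 = (x ^+ 2) ^+ 4 by rewrite -exprM.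
have := sqr_ge0 x; set y := x ^+ 2 => y0.
have -> : y ^+ 4 = (y ^+ 2) ^+ 2 by rewrite -exprM.
have := sqr_ge0 (y ^+ 2 - 2^-1); have := sqr_ge0 (y - 1); nra.
Qed.

Definition pos2_mean := \int[gauss]_x pos2 x.
Definition pos2_var := \int[gauss]_x ((pos2 x - pos2_mean) ^+ 2).
Definition mass_ge1 : R := fine (gauss `[1, +oo[%classic).

Lemma mass_ge1_gt0 : 0 < mass_ge1.
Proof.
have -> : mass_ge1 = Phi (- 1) by rewrite /mass_ge1 gaussE phi_upper_tail.
exact: Phi_gt0.
Qed.

Lemma ind1_int : gauss.-integrable setT (EFin \o (\1_(`[1, +oo[) : R -> R)).
Proof. exact: int_indic. Qed.

Lemma Rint_mass_ge1 : \int[gauss]_x \1_(`[1%R, +oo[) x = mass_ge1.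
Proof. exact: Rint_indic. Qed.

Lemma mass_ge1_le : mass_ge1 <= pos2_mean.
Proof.
rewrite -Rint_mass_ge1; apply: le_Rint => [||x]; [exact: ind1_int|exact: gauss_int_pos2|].
rewrite indicE; case: (boolP (x \in _)) => [|_]; last exact: pos2_ge0.
rewrite inE/= in_itv/= andbT => x1; rewrite pos2_pos; last by lra.
by rewrite expr_ge1//; lra.
Qed.

Lemma measurable_cpos2 : measurable_fun setT (fun x : R => pos2 x - pos2_mean).
Proof. by apply: measurable_funB => //; exact: measurable_pos2. Qed.

Lemma cpos2_pow4_int : gauss.-integrable setT (EFin \o (fun x : R => (pos2 x - pos2_mean) ^+ 4)).
Proof.
apply: (gauss_int_dom8 (C := 8 * (1 + pos2_mean ^+ 4))).
  by apply: measurable_funX; exact: measurable_cpos2.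
move=> x; rewrite ger0_norm ?exprn_even_ge0//.
have p8 : pos2 x ^+ 4 <= x ^+ 8.
  rewrite (_ : x ^+ 8 = (x ^+ 2) ^+ 4); last by rewrite -exprM.
  by apply: lerXn2r; rewrite ?nnegrE ?pos2_ge0 ?sqr_ge0// pos2_le.
have m4 : 0 <= pos2_mean ^+ 4 by rewrite exprn_even_ge0.
have x8 : 0 <= x ^+ 8 by rewrite exprn_even_ge0.
have : (pos2 x - pos2_mean) ^+ 4 <= 8 * (pos2 x ^+ 4 + pos2_mean ^+ 4).
  set a := pos2 x; set b := pos2_mean.
  have h1 : (a - b) ^+ 2 <= 2 * (a ^+ 2 + b ^+ 2) by have := sqr_ge0 (a + b); nra.
  have h2 : ((a - b) ^+ 2) ^+ 2 <= (2 * (a ^+ 2 + b ^+ 2)) ^+ 2.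
    by rewrite [leLHS]expr2 [leRHS]expr2; apply: ler_pM => //; exact: sqr_ge0.
  have h3 := sqr_ge0 (a ^+ 2 - b ^+ 2).
  have -> : (a - b) ^+ 4 = ((a - b) ^+ 2) ^+ 2 by rewrite -exprM.
  have -> : a ^+ 4 = (a ^+ 2) ^+ 2 by rewrite -exprM.
  have -> : b ^+ 4 = (b ^+ 2) ^+ 2 by rewrite -exprM.
  by apply: le_trans h2 _; lra.
have := mulr_ge0 m4 x8; lra.
Qed.

Lemma cpos2_int : gauss.-integrable setT (EFin \o (fun x : R => pos2 x - pos2_mean)).
Proof. exact: intB gauss_int_pos2 (int_cst _ _). Qed.

Lemma cpos2_sq_int : gauss.-integrable setT (EFin \o (fun x : R => (pos2 x - pos2_mean) ^+ 2)).
Proof.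
apply: (int_dom (g := fun x : R => 1 + (pos2 x - pos2_mean) ^+ 4)).
- by apply: measurable_funX; exact: measurable_cpos2.
- move=> x; rewrite ger0_norm ?sqr_ge0//; set a := _ - _.
  have -> : a ^+ 4 = (a ^+ 2) ^+ 2 by rewrite -exprM.
  have := sqr_ge0 (a ^+ 2 - 2^-1); nra.
- exact: intD (int_cst _ _) cpos2_pow4_int.
Qed.

Lemma cpos2_mean0 : \int[gauss]_x (pos2 x - pos2_mean) = 0.
Proof. by rewrite (RintB gauss_int_pos2 (int_cst _ pos2_mean)) Rint_cst subrr. Qed.

(** On the negative half-line [pos2] is 0, which differs from its mean. *)
Lemma pos2_var_gt0 : 0 < pos2_var.
Proof.
have m1 := lt_le_trans mass_ge1_gt0 mass_ge1_le.
have mI : measurable (`]-oo, 0%R]%classic : set R) by exact: measurable_itv.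
have iI := int_indic gauss mI.
apply: (@lt_le_trans _ _ (pos2_mean ^+ 2 * Phi (0 : R))).
  by rewrite mulr_gt0 ?exprn_gt0// Phi_gt0.
have -> : Phi (0 : R) = \int[gauss]_x \1_(`]-oo, 0%R]) x by rewrite Rint_indic.
rewrite -(RintZ _ iI); apply: le_Rint => [||x]; [exact: intZ|exact: cpos2_sq_int|].
rewrite indicE; case: (boolP (x \in _)) => [|_]; last by rewrite mulr0 sqr_ge0.
by rewrite inE/= in_itv/= => x0; rewrite pos2_neg// sub0r sqrrN mulr1.
Qed.

Definition pos2_sd : R := Num.sqrt pos2_var.

Lemma pos2_sd_gt0 : 0 < pos2_sd. Proof. by rewrite sqrtr_gt0 pos2_var_gt0. Qed.

Lemma pos2_sd_sq : pos2_sd ^+ 2 = pos2_var. Proof. by rewrite sqr_sqrtr// ltW// pos2_var_gt0. Qed.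

Definition stdpos2 (x : R) : R := pos2_sd^-1 * (pos2 x - pos2_mean).

Lemma measurable_stdpos2 : measurable_fun setT stdpos2.
Proof. by apply: measurable_funM => //; exact: measurable_cpos2. Qed.

HB.instance Definition _ := isMeasurableFun.Build _ _ _ _ stdpos2 measurable_stdpos2.

Definition stdpos2_law : probability R R := distribution gauss stdpos2.

Let i4 : gauss.-integrable setT (EFin \o (fun x : R => stdpos2 x ^+ 4)).
Proof.
have := intZ (pos2_sd^-1 ^+ 4) cpos2_pow4_int; apply: eq_integrable => // x _ /=.
by rewrite /stdpos2 exprMn.
Qed.

Lemma stdpos2_law_int4 : stdpos2_law.-integrable setT (EFin \o (fun x : R => x ^+ 4)).
Proof. by apply: int_distr. Qed.

Lemma stdpos2_law_mean : \int[stdpos2_law]_x x = 0.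
Proof.
rewrite (Rint_distr (f := id))//; last exact: intZ cpos2_int.
by rewrite (RintZ _ cpos2_int) cpos2_mean0 mulr0.
Qed.

Lemma stdpos2_law_var : \int[stdpos2_law]_x x ^+ 2 = 1.
Proof.
have E : (fun x : R => stdpos2 x ^+ 2) = (fun x => pos2_sd ^- 2 * (pos2 x - pos2_mean) ^+ 2).
  by apply/funext => x; rewrite exprMn exprVn.
have i2 : gauss.-integrable setT (EFin \o (fun x : R => stdpos2 x ^+ 2)).
  by rewrite E; exact: intZ cpos2_sq_int.
rewrite (Rint_distr (f := fun x : R => x ^+ 2))// E (RintZ _ cpos2_sq_int).
by rewrite -/pos2_var pos2_sd_sq mulVf// gt_eqF// pos2_var_gt0.
Qed.

Definition gain (a x : R) : R := pos2 (a + x) - pos2 x.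
Definition gain_mean (a : R) : R := \int[gauss]_x gain a x.

Lemma measurable_gain a : measurable_fun setT (gain a).
Proof.
apply: measurable_funB; last exact: measurable_pos2.
by apply: (measurableT_comp measurable_pos2); exact: measurable_funD.
Qed.

Section shift.
Variable a : R.
Hypothesis a0 : 0 <= a.

Lemma gain_ge x : (2 * a + a ^+ 2) * \1_(`[1%R, +oo[) x <= gain a x.
Proof.
have a0' := a0.
rewrite indicE; case: (boolP (x \in _)) => [|_].
  rewrite inE/= in_itv/= andbT => x1.
  by rewrite /gain !pos2_pos; [nra|lra|lra].
rewrite mulr0 /gain; have [x0|x0] := leP 0 x.
  by rewrite !pos2_pos; [nra|lra|lra].
by rewrite (pos2_neg (ltW x0)) subr0 pos2_ge0.
Qed.

(** The increment is within [2 * a * |x|] of the constant [a ^+ 2]; this gives its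
    mean up to constants and, as the variance is at most the second moment about
    any point, a variance of order [a ^+ 2] whatever the size of [a]. *)
Lemma gain_near x : `|gain a x - a ^+ 2| <= 2 * a * `|x|.
Proof.
have a0' := a0.
rewrite /gain; have [x0|x0] := leP 0 x.
  rewrite !pos2_pos; [|lra|lra].
  have -> : (a + x) ^+ 2 - x ^+ 2 - a ^+ 2 = 2 * a * x by ring.
  by rewrite normrM ger0_norm//; lra.
rewrite (pos2_neg (ltW x0)) subr0 (ltr0_norm x0) ler_norml.
have [ax|ax] := leP 0 (a + x).
  by rewrite pos2_pos//; apply/andP; split; nra.
by rewrite (pos2_neg (ltW ax)); apply/andP; split; nra.
Qed.

Lemma abs_int : gauss.-integrable setT (EFin \o (fun x : R => `|x|)).
Proof. by apply: int_norm; apply: int_id_of_sq; exact: gauss_int2. Qed.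

Let near_int : gauss.-integrable setT (EFin \o (fun x : R => gain a x - a ^+ 2)).
Proof.
apply: (int_dom (g := fun x : R => 2 * a * `|x|)); last exact: intZ abs_int.
- by apply: measurable_funB => //; exact: measurable_gain.
- exact: gain_near.
Qed.

Lemma gain_int : gauss.-integrable setT (EFin \o gain a).
Proof.
have := intD near_int (int_cst _ (a ^+ 2)); apply: eq_integrable => // x _ /=.
by rewrite subrK.
Qed.

Lemma gain_mean_ge : (2 * a + a ^+ 2) * mass_ge1 <= gain_mean a.
Proof.
rewrite -Rint_mass_ge1 -(RintZ _ ind1_int); apply: le_Rint => //; last exact: gain_ge.
  exact: intZ ind1_int.
exact: gain_int.
Qed.

Lemma gain_mean_le : gain_mean a <= 2 * a * (\int[gauss]_x `|x|) + a ^+ 2.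
Proof.
rewrite -[X in _ <= _ + X](Rint_cst gauss) -(RintZ _ abs_int).
rewrite -(RintD (intZ (2 * a) abs_int) (int_cst _ (a ^+ 2))).
apply: le_Rint => [||x]; first exact: gain_int.
  exact: (intD (intZ (2 * a) abs_int) (int_cst _ (a ^+ 2))).
have := gain_near x; rewrite ler_norml /= => /andP[_]; lra.
Qed.

Let near_sq_int : gauss.-integrable setT (EFin \o (fun x : R => (gain a x - a ^+ 2) ^+ 2)).
Proof.
apply: (int_dom (g := fun x : R => (2 * a) ^+ 2 * x ^+ 2)); last exact: intZ gauss_int2.
- by apply: measurable_funX; apply: measurable_funB => //; exact: measurable_gain.
- move=> x; rewrite ger0_norm ?sqr_ge0// -(real_normK (num_real x)) -exprMn.
  rewrite -(real_normK (num_real (gain a x - _))).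
  by apply: lerXn2r; rewrite ?nnegrE ?mulr_ge0//; exact: gain_near.
Qed.

Let cgainE (x : R) : (gain a x - gain_mean a) ^+ 2 = (gain a x - a ^+ 2) ^+ 2
  - ((2 * (gain_mean a - a ^+ 2)) * (gain a x - a ^+ 2) - (gain_mean a - a ^+ 2) ^+ 2).
Proof. ring. Qed.

Lemma cgain_sq_int : gauss.-integrable setT (EFin \o (fun x : R => (gain a x - gain_mean a) ^+ 2)).
Proof.
have := intB near_sq_int (intB (intZ (2 * (gain_mean a - a ^+ 2)) near_int)
  (int_cst _ ((gain_mean a - a ^+ 2) ^+ 2))).
by apply: eq_integrable => // x _ /=; rewrite cgainE.
Qed.

Lemma cgain_int : gauss.-integrable setT (EFin \o (fun x : R => gain a x - gain_mean a)).
Proof. exact: intB gain_int (int_cst _ _). Qed.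

Lemma cgain_mean0 : \int[gauss]_x (gain a x - gain_mean a) = 0.
Proof. by rewrite (RintB gain_int (int_cst _ (gain_mean a))) Rint_cst subrr. Qed.

Lemma gain_var_le : \int[gauss]_x ((gain a x - gain_mean a) ^+ 2) <=
  4 * (\int[gauss]_x x ^+ 2) * a ^+ 2.
Proof.
have mE : \int[gauss]_x (gain a x - a ^+ 2) = gain_mean a - a ^+ 2.
  by rewrite (RintB gain_int (int_cst _ (a ^+ 2))) Rint_cst.
apply: (@le_trans _ _ (\int[gauss]_x ((gain a x - a ^+ 2) ^+ 2))).
  have i3 := intZ (2 * (gain_mean a - a ^+ 2)) near_int.
  have i5 := int_cst gauss ((gain_mean a - a ^+ 2) ^+ 2).
  have -> : \int[gauss]_x ((gain a x - gain_mean a) ^+ 2) =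
      \int[gauss]_x ((gain a x - a ^+ 2) ^+ 2
  - ((2 * (gain_mean a - a ^+ 2)) * (gain a x - a ^+ 2) - (gain_mean a - a ^+ 2) ^+ 2)).
    by apply: eq_Rintegral => x _; rewrite cgainE.
  rewrite (RintB near_sq_int (intB i3 i5)) (RintB i3 i5) (RintZ _ near_int) mE Rint_cst.
  have := sqr_ge0 (gain_mean a - a ^+ 2); set y := gain_mean a - _; set J := Rintegral _ _ _; lra.
have -> : 4 * (\int[gauss]_x x ^+ 2) * a ^+ 2 = \int[gauss]_x ((2 * a) ^+ 2 * x ^+ 2).
  by rewrite (RintZ _ gauss_int2); ring.
apply: le_Rint => [||x]; [exact: near_sq_int|exact: intZ gauss_int2|].
rewrite -(real_normK (num_real x)) -exprMn -(real_normK (num_real (gain a x - _))).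
by apply: lerXn2r; rewrite ?nnegrE ?mulr_ge0//; exact: gain_near.
Qed.
End shift.
End onedim.

(** * The likelihood ratio statistic as a sum *)
Section orthant.
Context {R : realType}.

Lemma norm2_sq n (x : 'rV[R]_n) : norm2 x ^+ 2 = \sum_i x 0 i ^+ 2.
Proof. by rewrite /norm2 sqr_sqrtr// sumr_ge0// => i _; exact: sqr_ge0. Qed.

(** Only the minimal distance to the orthant enters the statistic, and the
    coordinatewise positive part attains it. *)
Lemma lrs_orthant n (y : 'rV[R]_n) : lrs (orthant R n) y = \sum_i pos2 (y 0 i).
Proof.
pose yp : 'rV[R]_n := \row_i Num.max (y 0 i) 0.
have yp_min (v : 'rV[R]_n) : orthant R n v -> norm2 (y - yp) <= norm2 (y - v).
  move=> v0; apply: ler_wsqrtr; apply: ler_sum => i _; rewrite !mxE.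
  have := v0 i; have [y0|y0] := leP 0 (y 0 i).
    by rewrite subrr expr0n/= => _; exact: sqr_ge0.
  nra.
have ypK : orthant R n yp by move=> i; rewrite mxE le_max lexx orbT.
have [pK min] : [set x | orthant R n x /\
    forall v, orthant R n v -> norm2 (y - x) <= norm2 (y - v)] (metric_proj (orthant R n) y).
  by apply: (xgetPex 0); exists yp; split.
have -> : lrs (orthant R n) y = norm2 y ^+ 2 - norm2 (y - yp) ^+ 2.
  rewrite /lrs; congr (_ - _ ^+ 2); apply/eqP; rewrite eq_le min//=.
  exact: yp_min pK.
rewrite !norm2_sq -sumrB; apply: eq_bigr => i _; rewrite !mxE.
have [y0|y0] := leP 0 (y 0 i); first by rewrite pos2_pos//; ring.
by rewrite (pos2_neg (ltW y0)); ring.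
Qed.
End orthant.

Section law_of_sums.
Context (R : realType) (d : measure_display) (T : measurableType d).
Context (P : probability T R) (n : nat) (xi : 'I_n -> {RV P >-> R}).
Hypothesis hxi : standard_gaussian xi.

Section sums.
Variable g : 'I_n -> {mfun R >-> R}.
Definition gsum (w : T) : R := \sum_(i < n) g i (xi i w).

Lemma measurable_gsum : measurable_fun setT gsum.
Proof. by apply: measurable_sum => i; exact: measurableT_comp. Qed.

HB.instance Definition _ := isMeasurableFun.Build _ _ _ _ gsum measurable_gsum.

Definition gsum_law : probability R R :=
  sum_law (map (fun i => distribution gauss (g i) : probability R R) (index_enum 'I_n)).

Lemma gsum_lawE A : measurable A -> P (gsum @^-1` A) = gsum_law A.
Proof.
move=> mA; apply: (psum_lawE hxi.2) => // i B mB.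
apply: (hxi.1 i (g i @^-1` B)).
by rewrite -[X in measurable X]setTI; exact: measurable_funP.
Qed.

Lemma integrable_gsum (f : R -> \bar R) : measurable_fun setT f ->
  gsum_law.-integrable setT f -> P.-integrable setT (f \o gsum).
Proof.
move=> mf fi; have /integrableP[_] := fi.
have -> : (\int[gsum_law]_x `|f x| = \int[distribution P gsum]_x `|f x|)%E.
  by apply/esym; apply: eq_measure_integral => A mA _; exact: gsum_lawE.
move=> H; apply/integrableP; split; first exact: measurableT_comp.
by rewrite ge0_integral_distribution// in H; exact: measurableT_comp.
Qed.

Lemma integral_gsum (f : R -> \bar R) : measurable_fun setT f ->
  gsum_law.-integrable setT f -> (\int[P]_w f (gsum w) = \int[gsum_law]_x f x)%E.
Proof.
move=> mf fi.
transitivity (\int[distribution P gsum]_x f x)%E; last first.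
  by apply: eq_measure_integral => A mA _; exact: gsum_lawE.
by rewrite integral_distribution//; exact: integrable_gsum.
Qed.

Lemma Rint_gsum (f : R -> R) : measurable_fun setT f ->
  gsum_law.-integrable setT (EFin \o f) -> \int[P]_w f (gsum w) = \int[gsum_law]_x f x.
Proof.
move=> mf fi; rewrite /Rintegral; congr fine.
by apply: (integral_gsum _ fi); exact/measurable_EFinP.
Qed.

Hypothesis g2 : forall i, gauss.-integrable setT (EFin \o (fun x : R => g i x ^+ 2)).
Hypothesis g0 : forall i, \int[gauss]_x g i x = 0.

Let g1 i : gauss.-integrable setT (EFin \o g i).
Proof.
apply: (int_dom (g := fun x : R => 1 + g i x ^+ 2)) => //.
- move=> x; rewrite -(real_normK (num_real (g i x))); have := sqr_ge0 (`|g i x| - 1); nra.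
- exact: intD (int_cst _ _) (g2 i).
Qed.

Lemma gsum_moments :
  [/\ gsum_law.-integrable setT (EFin \o (fun x : R => x ^+ 2)),
    \int[gsum_law]_x x = 0 &
    \int[gsum_law]_x (x ^+ 2) = \sum_(i < n) \int[gauss]_x (g i x ^+ 2)].
Proof.
have := @moments_sum_law R 'I_n (fun i => distribution gauss (g i)) (index_enum 'I_n).
case.
- by move=> i; apply: int_distr.
- by move=> i; rewrite (Rint_distr (f := id)).
move=> a b c; split => //; rewrite /gsum_law c; apply: eq_bigr => i _.
by rewrite (Rint_distr (f := fun x : R => x ^+ 2)).
Qed.

Lemma gsum_mean0 : \int[P]_w gsum w = 0.
Proof.
have [a b _] := gsum_moments; rewrite (Rint_gsum (f := id))//.
exact: int_id_of_sq.
Qed.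

Lemma gsum_sq_int : P.-integrable setT (EFin \o (fun w => gsum w ^+ 2)).
Proof.
have [a _ _] := gsum_moments.
have := integrable_gsum (f := EFin \o (fun x : R => x ^+ 2)).
by apply => //; exact/measurable_EFinP.
Qed.

Lemma gsum_int : P.-integrable setT (EFin \o gsum).
Proof.
have [a _ _] := gsum_moments.
have := integrable_gsum (f := EFin \o (fun x : R => x)); apply; first exact/measurable_EFinP.
exact: int_id_of_sq.
Qed.

Lemma gsum_second : \int[P]_w (gsum w ^+ 2) = \sum_(i < n) \int[gauss]_x (g i x ^+ 2).
Proof.
have [a _ <-] := gsum_moments; rewrite (Rint_gsum (f := fun x : R => x ^+ 2))//.
Qed.

Lemma gsum_tail (eps : R) : 0 < eps ->
  fine (P [set w | eps <= `|gsum w|]) <= (\sum_(i < n) \int[gauss]_x (g i x ^+ 2)) / eps ^+ 2.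
Proof.
move=> e0; pose A := [set x : R | eps <= `|x|].
have mA : measurable A.
  rewrite (_ : A = (fun x : R => `|x|) @^-1` `[eps, +oo[); last first.
    by apply/seteqP; split => x; rewrite /= in_itv/= andbT.
  have mn : measurable_fun setT (fun x : R => `|x|) by [].
  by rewrite -[X in measurable X]setTI; exact: mn.
rewrite (_ : [set w | _] = gsum @^-1` A)// gsum_lawE//.
have [a _ <-] := gsum_moments.
rewrite ler_pdivlMr ?exprn_gt0// mulrC.
have iA := int_indic gsum_law mA.
rewrite -Rint_indic// -(RintZ _ iA); apply: le_Rint => [||x]//; first exact: intZ.
rewrite indicE; case: (boolP (x \in A)) => [|_]; last by rewrite mulr0 sqr_ge0.
rewrite inE/= mulr1 => ex; rewrite -[leRHS](real_normK (num_real x)).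
by apply: lerXn2r; rewrite ?nnegrE// ltW.
Qed.
End sums.
End law_of_sums.

(** * Decomposition of the statistic *)
Section stdgain.
Context {R : realType}.

Definition stdgain (a x : R) : R := pos2_sd^-1 * (gain a x - gain_mean a).

Lemma measurable_stdgain a : measurable_fun setT (stdgain a).
Proof.
apply: measurable_funM => //; apply: measurable_funB => //; exact: measurable_gain.
Qed.

HB.instance Definition _ a := isMeasurableFun.Build _ _ _ _ (stdgain a) (measurable_stdgain a).

Lemma map_const_law (I J : Type) (r : probability R R) (s : seq I) (s' : seq J) :
  size s = size s' -> map (fun=> r) s = map (fun=> r) s'.
Proof. by elim: s s' => [|i s IH] [|j s'] //= [/IH->]. Qed.

Lemma gsum_law_const n :
  gsum_law (fun _ : 'I_n => stdpos2 : {mfun R >-> R}) = iid_sum stdpos2_law n.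
Proof.
rewrite /gsum_law /iid_sum /stdpos2_law; congr sum_law; apply: map_const_law.
by rewrite size_iota -[RHS]card_ord cardT enumT [index_enum _]unlock.
Qed.
End stdgain.

Section test.
Context (R : realType) (d : measure_display) (T : measurableType d).
Context (P : probability T R) (n : nat) (xi : 'I_n.+1 -> {RV P >-> R}).
Hypothesis hxi : standard_gaussian xi.
Let K := orthant R n.+1.
Let N : R := n.+1%:R.
Let rn : R := Num.sqrt N.

Let N0 : 0 < N. Proof. by rewrite ltr0n. Qed.
Let rn0 : 0 < rn. Proof. by rewrite sqrtr_gt0. Qed.
Let sd0 : 0 < pos2_sd :> R. Proof. exact: pos2_sd_gt0. Qed.

(** The three parts of the statistic, in units of the standard deviation of one
    summand under the null hypothesis: the null statistic, the fluctuation of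
    what [mu] adds to it, and the mean of what [mu] adds to it. *)
Definition null_sum : T -> R := gsum xi (fun _ => stdpos2 : {mfun R >-> R}).
Definition shift_sum (mu : 'rV[R]_n.+1) : T -> R :=
  gsum xi (fun i => stdgain (mu 0 i) : {mfun R >-> R}).
Definition drift (mu : 'rV[R]_n.+1) : R := pos2_sd^-1 * \sum_i gain_mean (mu 0 i).

Lemma lrs_decomp mu w : lrs K (observation xi mu w) =
  pos2_sd * (null_sum w + shift_sum mu w + drift mu) + N * pos2_mean.
Proof.
rewrite lrs_orthant /null_sum /shift_sum /drift /gsum.
have -> : N * pos2_mean = \sum_(i < n.+1) pos2_mean.
  by rewrite sumr_const card_ord -[RHS]mulr_natl.
rewrite mulr_sumr -!big_split/= mulr_sumr -big_split/=; apply: eq_bigr => i _.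
rewrite /observation !mxE /stdpos2 /stdgain /gain; field; exact: lt0r_neq0.
Qed.

Lemma gain_mean0 : gain_mean (0 : R) = 0.
Proof.
rewrite /gain_mean /gain -[RHS](Rint_cst gauss); apply: eq_Rintegral => x _.
by rewrite add0r subrr.
Qed.

Lemma stdgain0 x : stdgain (0 : R) x = 0.
Proof. by rewrite /stdgain gain_mean0 /gain add0r subrr subr0 mulr0. Qed.

Lemma shift_sum0 w : shift_sum 0 w = 0.
Proof. by rewrite /shift_sum /gsum big1// => i _; rewrite mxE; exact: stdgain0. Qed.

Lemma drift0 : drift 0 = 0.
Proof. by rewrite /drift big1 ?mulr0// => i _; rewrite mxE gain_mean0. Qed.

Lemma lrs_null w : lrs K (observation xi 0 w) = pos2_sd * null_sum w + N * pos2_mean.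
Proof. by rewrite lrs_decomp shift_sum0 drift0 !addr0. Qed.

Let i2 : gauss.-integrable setT (EFin \o (fun x : R => stdpos2 x ^+ 2)).
Proof.
have := intZ (pos2_sd ^- 2) (@cpos2_sq_int R); apply: eq_integrable => // x _ /=.
by rewrite /stdpos2 exprMn exprVn.
Qed.

Let m0 : \int[gauss]_x stdpos2 x = 0 :> R.
Proof. by rewrite (RintZ _ cpos2_int) cpos2_mean0 mulr0. Qed.

Let m1 : \int[gauss]_x (stdpos2 x ^+ 2) = 1 :> R.
Proof.
have := @stdpos2_law_var R; rewrite (Rint_distr (f := fun x : R => x ^+ 2))//.
Qed.

Lemma null_sum_mean : \int[P]_w null_sum w = 0.
Proof. by apply: (gsum_mean0 hxi) => i. Qed.

Lemma null_sum_second : \int[P]_w (null_sum w ^+ 2) = N.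
Proof.
rewrite (gsum_second hxi) => [|i|i]//.
rewrite (eq_bigr (fun=> 1)) => [|i _]; last exact: m1.
by rewrite sumr_const card_ord.
Qed.

Lemma null_sum_sq_int : P.-integrable setT (EFin \o (fun w => null_sum w ^+ 2)).
Proof. exact: gsum_sq_int. Qed.

Lemma null_sum_int : P.-integrable setT (EFin \o null_sum).
Proof. exact: gsum_int. Qed.

Let expT0 : ('E_P[lrs K \o observation xi 0] = (N * pos2_mean)%:E)%E.
Proof.
have i := intD (intZ pos2_sd null_sum_int) (int_cst P (N * pos2_mean)).
rewrite unlock.
transitivity (\int[P]_w ((pos2_sd * null_sum w + N * pos2_mean)%R)%:E)%E.
  by apply: eq_integral => w _; rewrite /= lrs_null.
rewrite -[LHS]fineK; last exact: integrable_fin_num i.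
congr EFin; rewrite -[LHS]/(\int[P]_w (pos2_sd * null_sum w + N * pos2_mean)).
rewrite (RintD (intZ pos2_sd null_sum_int) (int_cst P (N * pos2_mean))).
by rewrite (RintZ _ null_sum_int) null_sum_mean mulr0 add0r Rint_cst.
Qed.

Lemma null_meanE : null_mean xi K = N * pos2_mean.
Proof. by rewrite /null_mean /expect expT0. Qed.

Lemma null_sdE : null_sd xi K = rn * pos2_sd.
Proof.
have -> : rn * pos2_sd = Num.sqrt (pos2_sd ^+ 2 * N).
  by rewrite sqrtrM ?sqr_ge0// sqrtr_sqr ger0_norm ?(ltW sd0)// mulrC.
have -> : pos2_sd ^+ 2 * N = \int[P]_w (pos2_sd ^+ 2 * null_sum w ^+ 2).
  by rewrite (RintZ _ null_sum_sq_int) null_sum_second.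
rewrite /null_sd; congr Num.sqrt; rewrite /variance unlock expT0 unlock /Rintegral; congr fine.
apply: eq_integral => w _; congr EFin.
transitivity ((lrs K (observation xi 0 w) - N * pos2_mean) *
  (lrs K (observation xi 0 w) - N * pos2_mean)).
  by [].
by rewrite lrs_null addrK; ring.
Qed.

Definition stat mu w : R := null_sum w + shift_sum mu w + drift mu.

Lemma measurable_stat mu : measurable_fun setT (stat mu).
Proof.
apply: measurable_funD => //; apply: measurable_funD; exact: measurable_gsum.
Qed.

Lemma measurable_reject mu (z : R) : measurable [set w | z * rn < `|stat mu w|].
Proof.
rewrite (_ : [set _ | _] = (fun w => `|stat mu w|) @^-1` `]z * rn, +oo[).
  rewrite -[X in measurable X]setTI; apply: measurableT_comp => //; exact: measurable_stat.
by apply/seteqP; split => x; rewrite /= in_itv/= andbT.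
Qed.

Lemma expect_psi mu z :
  expect xi mu (psi_ts K z (null_mean xi K) (null_sd xi K)) =
  fine (P [set w | z * rn < `|stat mu w|]).
Proof.
rewrite /expect; congr fine; rewrite unlock.
have mA := measurable_reject mu z; set A := [set w | z * rn < _] in mA *.
have -> : P A = (\int[P]_w (\1_A w)%:E)%E by rewrite integral_indic// setIT.
apply: eq_integral => w _; congr EFin.
rewrite /= /psi_ts !indicE; congr (nat_of_bool _)%:R.
have E : `|lrs K (observation xi mu w) - null_mean xi K| / null_sd xi K = `|stat mu w| / rn.
  rewrite null_meanE null_sdE lrs_decomp addrK -/(stat mu w) normrM (gtr0_norm sd0).
  by field; rewrite !gt_eqF.
by apply/idP/idP; rewrite !inE/= E ltr_pdivlMr.
Qed.

Lemma null_sum_cdf (r : R) :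
  fine (P [set w | null_sum w <= rn * r]) =
  fine (iid_sum stdpos2_law n.+1 `]-oo, rn * r]%classic).
Proof.
rewrite -gsum_law_const -(gsum_lawE hxi)//; congr fine; congr (P _).
Qed.

Lemma null_sum_tail eps : 0 < eps -> fine (P [set w | eps <= `|null_sum w|]) <= N / eps ^+ 2.
Proof.
move=> e0; apply: le_trans (gsum_tail hxi _ _ e0) _ => [i|i|]//.
rewrite (eq_bigr (fun=> 1)) => [|i _]; last exact: m1.
by rewrite sumr_const card_ord.
Qed.

Section shifted.
Variable mu : 'rV[R]_n.+1.
Hypothesis mu0 : K mu.

Definition abs_mean : R := \int[gauss]_x `|x|.
Definition sq_mean : R := \int[gauss]_x x ^+ 2.

Lemma sq_mean_ge0 : 0 <= sq_mean.
Proof. by apply: Rintegral_ge0 => x _; exact: sqr_ge0. Qed.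

Lemma abs_mean_ge0 : 0 <= abs_mean.
Proof. exact: Rintegral_ge0. Qed.

Lemma shift_sum_tail eps : 0 < eps ->
  fine (P [set w | eps <= `|shift_sum mu w|]) <= 4 * sq_mean * norm2 mu ^+ 2 / pos2_var / eps ^+ 2.
Proof.
move=> e0.
have sqE a : (fun x : R => stdgain a x ^+ 2) =
    (fun x => pos2_sd ^- 2 * (gain a x - gain_mean a) ^+ 2).
  by apply/funext => x; rewrite exprMn exprVn.
apply: le_trans (gsum_tail hxi _ _ e0) _ => [i|i|].
- by rewrite sqE; apply: intZ; exact: cgain_sq_int (mu0 i).
- by rewrite (RintZ _ (cgain_int (mu0 i))) (cgain_mean0 (mu0 i)) mulr0.
rewrite ler_pM2r ?invr_gt0 ?exprn_gt0// norm2_sq mulr_sumr mulr_suml.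
apply: ler_sum => i _; rewrite sqE (RintZ _ (cgain_sq_int (mu0 i))) pos2_sd_sq mulrC.
by rewrite ler_pM2r ?invr_gt0 ?pos2_var_gt0//; exact: gain_var_le.
Qed.

Definition signal : R := Num.max (norm1 mu) (norm2 mu ^+ 2).

Lemma norm1_orthant : norm1 mu = \sum_i mu 0 i.
Proof. by apply: eq_bigr => i _; rewrite ger0_norm//; exact: mu0. Qed.

Lemma signal_ge0 : 0 <= signal.
Proof. by rewrite /signal le_max sqr_ge0 orbT. Qed.

(** With [drift_le], the drift has exactly the order of the signal. *)
Lemma drift_ge : pos2_sd^-1 * mass_ge1 * signal <= drift mu.
Proof.
rewrite /drift -mulrA ler_pM2l ?invr_gt0//.
have D : (2 * norm1 mu + norm2 mu ^+ 2) * mass_ge1 <= \sum_i gain_mean (mu 0 i).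
  rewrite norm1_orthant norm2_sq mulr_sumr -big_split/= mulr_suml.
  by apply: ler_sum => i _; exact: gain_mean_ge.
apply: le_trans D; rewrite mulrC ler_pM2r ?mass_ge1_gt0//.
have n1 : 0 <= norm1 mu by rewrite norm1_orthant sumr_ge0.
have n2 := sqr_ge0 (norm2 mu).
by rewrite /signal ge_max; apply/andP; split; lra.
Qed.

Lemma drift_le : drift mu <= pos2_sd^-1 * (2 * abs_mean + 1) * signal.
Proof.
rewrite /drift -mulrA ler_pM2l ?invr_gt0//.
have D : \sum_i gain_mean (mu 0 i) <= 2 * abs_mean * norm1 mu + norm2 mu ^+ 2.
  rewrite norm1_orthant norm2_sq mulr_sumr -big_split/=.
  by apply: ler_sum => i _; rewrite [X in X + _]mulrAC; exact: gain_mean_le.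
apply: le_trans D _; rewrite [leRHS]mulrDl mul1r; apply: lerD.
  by apply: ler_wpM2l; [rewrite mulr_ge0// abs_mean_ge0|rewrite /signal le_max lexx].
by rewrite /signal le_max lexx orbT.
Qed.

Lemma drift_ge0 : 0 <= drift mu.
Proof.
apply: le_trans drift_ge; rewrite mulr_ge0 ?signal_ge0// mulr_ge0 ?invr_ge0 ?(ltW sd0)//.
exact/ltW/mass_ge1_gt0.
Qed.

End shifted.
End test.

(** * Level and power in a fixed dimension *)
Section prob.
Context (d : measure_display) (T : measurableType d) (R : realType) (P : probability T R).
Implicit Types A B : set T.

Lemma pr_le A B : measurable A -> measurable B -> A `<=` B -> fine (P A) <= fine (P B).
Proof. by move=> mA mB AB; rewrite fine_le ?fin_num_measure// le_measure ?inE. Qed.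

Lemma pr_le1 A : measurable A -> fine (P A) <= 1.
Proof. by move=> mA; rewrite -lee_fin fineK ?fin_num_measure// probability_le1. Qed.

Lemma pr_setC A : measurable A -> fine (P (~` A)) = 1 - fine (P A).
Proof. by move=> mA; rewrite probability_setC// fineB// fin_num_measure. Qed.

Lemma pr_setU_le A B : measurable A -> measurable B ->
  fine (P (A `|` B)) <= fine (P A) + fine (P B).
Proof.
move=> mA mB; have mAB : measurable (A `|` B) by exact: measurableU.
rewrite -lee_fin EFinD !fineK ?fin_num_measure//; exact: measureU2.
Qed.

Lemma pr_setU A B : measurable A -> measurable B -> A `&` B = set0 ->
  fine (P (A `|` B)) = fine (P A) + fine (P B).
Proof.
move=> mA mB AB; rewrite measureU// fineD// fin_num_measure//.
Qed.

Section rv.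
Variable X : T -> R.
Hypothesis mX : measurable_fun setT X.

Lemma measurable_rv_le (a : R) : measurable [set w | X w <= a].
Proof.
rewrite (_ : [set _ | _] = X @^-1` `]-oo, a]); last by apply/seteqP; split => x; rewrite /= in_itv.
by rewrite -[X in measurable X]setTI; exact: mX.
Qed.

Lemma measurable_rv_lt (a : R) : measurable [set w | X w < a].
Proof.
rewrite (_ : [set _ | _] = X @^-1` `]-oo, a[); last by apply/seteqP; split => x; rewrite /= in_itv.
by rewrite -[X in measurable X]setTI; exact: mX.
Qed.

Lemma measurable_rv_absge (a : R) : measurable [set w | a <= `|X w|].
Proof.
rewrite (_ : [set _ | _] = (fun w => `|X w|) @^-1` `[a, +oo[).
  by rewrite -[X in measurable X]setTI; apply: measurableT_comp => //.
by apply/seteqP; split => x; rewrite /= in_itv/= andbT.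
Qed.
End rv.
End prob.

Section bounds.
Context (R : realType) (d : measure_display) (T : measurableType d).
Context (P : probability T R) (n : nat) (xi : 'I_n.+1 -> {RV P >-> R}).
Hypothesis hxi : standard_gaussian xi.
Let K := orthant R n.+1.
Let N : R := n.+1%:R.
Let rn : R := Num.sqrt N.
Variables (C z : R).
Hypothesis hC : forall r : R,
  `|fine (iid_sum stdpos2_law n.+1 `]-oo, rn * r]%classic) - Phi r| <= C / rn.
Hypothesis C0 : 0 < C.
Hypothesis z0 : 0 < z.
Notation W := (null_sum xi).
Notation Z := (shift_sum xi).

Let N0 : 0 < N. Proof. by rewrite ltr0n. Qed.
Let rn0 : 0 < rn. Proof. by rewrite sqrtr_gt0. Qed.
Let mW : measurable_fun setT W. Proof. exact: measurable_gsum. Qed.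
Let mZ mu : measurable_fun setT (Z mu). Proof. exact: measurable_gsum. Qed.
Let sd0 : 0 < pos2_sd :> R. Proof. exact: pos2_sd_gt0. Qed.

Let F (r : R) : R := fine (P [set w | W w <= rn * r]).

Let FE r : `|F r - Phi r| <= C / rn.
Proof. by rewrite /F (null_sum_cdf hxi); exact: hC. Qed.

(** The rejection region is the union of two half-lines.  The bound on the
    distribution function applies to closed lower half-lines, so the open one is
    squeezed: shrinking it by [C / rn] costs another [C / rn] at most. *)
Lemma level_bound (a : R) : Phi z = 1 - a / 2 ->
  `|fine (P [set w | z * rn < `|stat xi 0 w|]) - a| <= 3 * C / rn.
Proof.
move=> Pz.
have zr : 0 < z * rn by rewrite mulr_gt0.
have -> : [set w | z * rn < `|stat xi 0 w|] =
    ~` [set w | W w <= rn * z] `|` [set w | W w < rn * - z].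
  apply/seteqP; split => w /=; rewrite /stat shift_sum0 drift0 !addr0 mulrN (mulrC rn).
    by rewrite lter_normr => /orP[H|H]; [left; apply/negP; rewrite -ltNge|right; lra].
  by case=> [/negP|H]; rewrite lter_normr; [rewrite -ltNge => ->|apply/orP; right; lra].
have mA := measurable_rv_le mW (rn * z); have mB := measurable_rv_lt mW (rn * - z).
rewrite pr_setU//; [|exact: measurableC|]; last first.
  apply/seteqP; split => w //= [/negP]; rewrite -ltNge mulrN (mulrC rn) => h1 h2; lra.
rewrite pr_setC// -/(F z).
have c0 : 0 < C / rn by rewrite divr_gt0.
have b1 : fine (P [set w | W w < rn * - z]) <= F (- z).
  by apply: pr_le => // [|w /ltW//]; exact: measurable_rv_le.
have b2 : F (- z - C / rn) <= fine (P [set w | W w < rn * - z]).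
  apply: pr_le => //; first exact: measurable_rv_le.
  move=> w /= /le_lt_trans; apply; rewrite ltr_pM2l//; lra.
have /andP[_] := @Phi_increment R (- z - C / rn) (- z) ltac:(lra).
move: (FE z) (FE (- z)) (FE (- z - C / rn)).
rewrite !ler_norml PhiN Pz => /andP[? ?] /andP[? ?] /andP[? ?] ?.
by rewrite -mulrA; apply/andP; split; lra.
Qed.

Section shifted.
Variable mu : 'rV[R]_n.+1.
Hypothesis mu0 : K mu.
Notation M := (signal mu).
Notation dd := (drift mu).

Let M0 : 0 <= M. Proof. exact: signal_ge0. Qed.
Let norm2_M : norm2 mu ^+ 2 <= M. Proof. by rewrite /signal le_max lexx orbT. Qed.

(** The drift is at least twice the critical value, so accepting forces the null
    statistic or the fluctuation to be at least a quarter of the drift; both have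
    variance of order at most [N + M], to which Chebyshev's inequality applies. *)
Lemma power_bound : 0 < M -> 2 * z * rn * pos2_sd <= mass_ge1 * M ->
  1 - 16 * pos2_sd ^+ 2 / mass_ge1 ^+ 2 * ((N + 4 * sq_mean R / pos2_var * M) / M ^+ 2) <=
  fine (P [set w | z * rn < `|stat xi mu w|]).
Proof.
move=> Mp hM; have m1 := @mass_ge1_gt0 R.
have zr : 0 < z * rn by rewrite mulr_gt0.
pose L0 := pos2_sd^-1 * mass_ge1 * M.
have L00 : 0 < L0 by rewrite /L0 !mulr_gt0 ?invr_gt0.
have ddL : L0 <= dd by exact: drift_ge.
have L0z : 2 * (z * rn) <= L0.
  by rewrite /L0 -mulrA ler_pdivlMl//; lra.
have e0 : 0 < L0 / 4 by rewrite divr_gt0.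
have mR := measurable_reject xi mu z.
have mA := measurable_rv_absge mW (L0 / 4); have mB := measurable_rv_absge (@mZ mu) (L0 / 4).
have sub : ~` [set w | z * rn < `|stat xi mu w|] `<=`
    [set w | L0 / 4 <= `|W w|] `|` [set w | L0 / 4 <= `|Z mu w|].
  move=> w /= /negP; rewrite -leNgt /stat ler_norml => /andP[_ h].
  have [h1|h1] := leP (L0 / 4) `|W w|; first by left.
  have [h2|h2] := leP (L0 / 4) `|Z mu w|; first by right.
  by exfalso; move: h1 h2; rewrite !lter_norml => /andP[? ?] /andP[? ?]; lra.
have := pr_le P (measurableC mR) (measurableU _ _ mA mB) sub.
move=> /le_trans /(_ (pr_setU_le P mA mB)).
rewrite pr_setC// => H.
have tW := null_sum_tail hxi e0; have tZ := shift_sum_tail hxi mu0 e0.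
have tZ' : 4 * sq_mean R * norm2 mu ^+ 2 / pos2_var / (L0 / 4) ^+ 2 <=
    4 * sq_mean R / pos2_var * M / (L0 / 4) ^+ 2.
  rewrite ler_pM2r ?invr_gt0 ?exprn_gt0// mulrAC.
  apply: ler_wpM2l => //; rewrite mulr_ge0 ?invr_ge0 ?(ltW (pos2_var_gt0))//.
  by rewrite mulr_ge0 ?sq_mean_ge0.
have E : 16 * pos2_sd ^+ 2 / mass_ge1 ^+ 2 * ((N + 4 * sq_mean R / pos2_var * M) / M ^+ 2) =
   N / (L0 / 4) ^+ 2 + 4 * sq_mean R / pos2_var * M / (L0 / 4) ^+ 2.
  by rewrite /L0; field; rewrite !gt_eqF// pos2_var_gt0.
by rewrite E; lra.
Qed.

(** When the signal is at most of order [rn], the test accepts as soon as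
    [W / rn] lies in the interval of length [z] centred at [- drift mu / rn] and
    [|Z| < z / 2 * rn].  The drift being bounded by a multiple of [rn], the normal
    law gives this interval a mass bounded below, and the Berry-Esseen bound
    transfers it to [W]; by Chebyshev's inequality the condition on [Z] fails with
    probability of order [1 / rn] only. *)
Lemma accept_bound (L : R) : 0 <= L -> M <= L * rn ->
  fine (P [set w | z * rn < `|stat xi mu w|]) <=
  1 - z * normal_pdf 0 1 (z / 2 + pos2_sd^-1 * (2 * abs_mean R + 1) * L)
    + (2 * C + 16 * sq_mean R * L / (pos2_var * z ^+ 2)) / rn.
Proof.
move=> L0 ML; have z0' := z0.
set dm := pos2_sd^-1 * (2 * abs_mean R + 1) * L.
have k0 : 0 <= pos2_sd^-1 * (2 * abs_mean R + 1).
  by rewrite mulr_ge0 ?invr_ge0 ?(ltW sd0)// addr_ge0// mulr_ge0// abs_mean_ge0.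
pose dn := dd / rn.
have dn0 : 0 <= dn by rewrite divr_ge0 ?(ltW rn0)//; exact: drift_ge0.
have dnm : dn <= dm.
  rewrite ler_pdivrMr//; apply: le_trans (drift_le mu0) _.
  by rewrite /dm -[leRHS]mulrA; apply: ler_wpM2l.
have ddE : dd = dn * rn by rewrite /dn divfK// gt_eqF.
pose a := - (z / 2) - dn; pose b := z / 2 - dn.
have mR := measurable_reject xi mu z.
have e0 : 0 < z / 2 * rn by rewrite mulr_gt0// divr_gt0.
have mA := measurable_rv_le mW (rn * a); have mB := measurable_rv_le mW (rn * b).
have mD := measurable_rv_absge (@mZ mu) (z / 2 * rn).
have sub : [set w | z * rn < `|stat xi mu w|] `<=`
    ([set w | W w <= rn * a] `|` ~` [set w | W w <= rn * b]) `|` [set w | z / 2 * rn <= `|Z mu w|].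
  move=> w /= hw.
  have [h1|h1] := leP (W w) (rn * a); first by left; left.
  have [h2|h2] := leP (W w) (rn * b); last by left; right.
  have [h3|h3] := leP (z / 2 * rn) `|Z mu w|; first by right.
  exfalso; move: hw; apply/negP; rewrite -leNgt /stat ddE.
  move: h1 h2 h3; rewrite /a /b mulrBr mulrBr mulrN lter_norml => h1 h2 /andP[h3 h4].
  rewrite ler_norml; apply/andP; split; lra.
have mC := measurableC mB; have mAC := measurableU _ _ mA mC.
have := pr_le P mR (measurableU _ _ mAC mD) sub.
move=> /le_trans /(_ (pr_setU_le P mAC mD)) H.
have H2 := pr_setU_le P mA mC; rewrite pr_setC// -/(F a) -/(F b) in H2.
have tZ := shift_sum_tail hxi mu0 e0.
have tZ' : 4 * sq_mean R * norm2 mu ^+ 2 / pos2_var / (z / 2 * rn) ^+ 2 <=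
    16 * sq_mean R * L / (pos2_var * z ^+ 2) / rn.
  have -> : 16 * sq_mean R * L / (pos2_var * z ^+ 2) / rn =
      (4 * sq_mean R / pos2_var / (z / 2 * rn) ^+ 2) * (L * rn).
    by field; rewrite !gt_eqF// pos2_var_gt0.
  have -> : 4 * sq_mean R * norm2 mu ^+ 2 / pos2_var / (z / 2 * rn) ^+ 2 =
      (4 * sq_mean R / pos2_var / (z / 2 * rn) ^+ 2) * norm2 mu ^+ 2.
    by field; rewrite !gt_eqF// pos2_var_gt0.
  apply: ler_wpM2l; last exact: le_trans norm2_M ML.
  rewrite !mulr_ge0 ?invr_ge0 ?(ltW pos2_var_gt0) ?exprn_ge0 ?(ltW e0)//.
  exact: sq_mean_ge0.
have ab : a <= b by rewrite /a /b; lra.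
have := @Phi_increment_ge R a b (z / 2 + dm) ab ltac:(rewrite /a; lra) ltac:(rewrite /b; lra).
have -> : b - a = z by rewrite /a /b; lra.
move: (FE a) (FE b); rewrite !ler_norml => /andP[? ?] /andP[? ?] ?.
rewrite mulrDl -[2 * C / rn]mulrA; lra.
Qed.
End shifted.
End bounds.

(** * Level and consistency of the test *)
Section test_bounds.
Context (R : realType) (d : measure_display) (T : measurableType d).
Context (P : probability T R) (n : nat) (xi : 'I_n -> {RV P >-> R}).
Hypothesis hxi : standard_gaussian xi.
Hypothesis n0 : (0 < n)%N.
Variables (C z : R).
Hypothesis hC : forall m r,
  `|fine (iid_sum stdpos2_law m.+1 `]-oo, Num.sqrt m.+1%:R * r]%classic) - Phi r| <=
    C / Num.sqrt m.+1%:R.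
Hypotheses (C0 : 0 < C) (z0 : 0 < z).
Let K := orthant R n.
Let power mu := expect xi mu (psi_ts K z (null_mean xi K) (null_sd xi K)).
Let rn : R := Num.sqrt n%:R.

Lemma test_level a : Phi z = 1 - a / 2 -> `|power 0 - a| <= 3 * C / rn.
Proof.
rewrite /power /rn /K; case: n xi hxi n0 => // m xi' hxi' _ hz.
by rewrite (expect_psi hxi'); apply: level_bound.
Qed.

Lemma test_le1 mu : power mu <= 1.
Proof.
rewrite /power /rn /K; case: n xi hxi n0 mu => // m xi' hxi' _ mu.
by rewrite (expect_psi hxi'); apply: pr_le1; exact: measurable_reject.
Qed.

Variable mu : 'rV[R]_n.
Hypothesis mu0 : K mu.
Notation M := (Num.max (norm1 mu) (norm2 mu ^+ 2)).

Lemma test_power : 0 < M -> 2 * z * rn * pos2_sd <= mass_ge1 * M ->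
  1 - 16 * pos2_sd ^+ 2 / mass_ge1 ^+ 2 * ((n%:R + 4 * sq_mean R / pos2_var * M) / M ^+ 2) <= power mu.
Proof.
move: mu0; rewrite /power /rn /K; case: n xi hxi n0 mu => // m xi' hxi' _ mu' h0 M0 hM.
by rewrite (expect_psi hxi'); apply: power_bound.
Qed.

Lemma test_accept (L : R) : 0 <= L -> M <= L * rn -> power mu <=
  1 - z * normal_pdf 0 1 (z / 2 + pos2_sd^-1 * (2 * abs_mean R + 1) * L)
    + (2 * C + 16 * sq_mean R * L / (pos2_var * z ^+ 2)) / rn.
Proof.
move: mu0; rewrite /power /rn /K; case: n xi hxi n0 mu => // m xi' hxi' _ mu' h0 L0 hM.
by rewrite (expect_psi hxi'); apply: accept_bound.
Qed.
End test_bounds.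

Theorem corollary4p2 (R : realType)
    (d : nat -> measure_display) (T : forall n, measurableType (d n))
    (P : forall n, probability (T n) R)
    (xi : forall n, 'I_n -> {RV (P n) >-> R})
    (hxi : forall n, standard_gaussian (xi n))
    (alpha z : R) (halpha : 0 < alpha < 1)
    (hz : upper_quantile (alpha / 2) z) :
  let K := orthant R in
  let psi n := psi_ts (K n) z (null_mean (xi n) (K n)) (null_sd (xi n) (K n)) in
  ((fun n => expect (xi n) 0 (psi n) - alpha)
     =O_\oo (fun n => (Num.sqrt n%:R)^-1 : R)) /\
  (forall mu : forall n, 'rV[R]_n, (forall n, K n (mu n)) ->
     (expect (xi n) (mu n) (psi n) @[n --> \oo] --> (1 : R)) <->
     much_greater (fun n => Num.max (norm1 (mu n)) (norm2 (mu n) ^+ 2))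
                  (fun n => Num.sqrt n%:R)).
Proof.
move=> K psi.
have Pz := upper_quantile_Phi hz.
have z0 : 0 < z by apply: upper_quantile_gt0 hz; case/andP: halpha; lra.
have [C C0 hC] := berry_esseen (@stdpos2_law_int4 R) (@stdpos2_law_mean R) (@stdpos2_law_var R).
have rn0 n : (0 < n)%N -> 0 < Num.sqrt (n%:R : R) by move=> n0; rewrite sqrtr_gt0 ltr0n.
have sqrt_oo (A : R) : \forall n \near \oo, A <= Num.sqrt (n%:R : R).
  near=> n.
  have An : A ^+ 2 <= n%:R by near: n; exact: nbhs_infty_ger.
  by rewrite (le_trans (ler_norm A))// -sqrtr_sqr ler_wsqrtr.
split.
  apply/eqO_exP; exists (3 * C); first by rewrite mulr_gt0.
  near=> n; have n0 : (0 < n)%N by near: n; exact: nbhs_infty_gt.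
  rewrite /= (ger0_norm (x := _^-1)) ?invr_ge0 ?(ltW (rn0 _ n0))//.
  exact: test_level.
move=> mu hmu; split.
  move=> cv; apply/cvgryPge => A.
  (* At a large index with signal below [A * sqrt n] the power would stay below
     [1 - dl] up to a vanishing error, against its convergence to 1. *)
  pose L : R := `|A|; have L0 : 0 <= L by exact: normr_ge0.
  set dl : R := z * normal_pdf 0 1 (z / 2 + pos2_sd^-1 * (2 * abs_mean R + 1) * L).
  have dl0 : 0 < dl by rewrite mulr_gt0// phi_gt0.
  pose C2 : R := 2 * C + 16 * sq_mean R * L / (pos2_var * z ^+ 2).
  have C20 : 0 <= C2.
    rewrite addr_ge0 ?mulr_ge0 ?(ltW C0) ?sq_mean_ge0 ?invr_ge0//.
    by rewrite mulr_ge0 ?(ltW pos2_var_gt0)// sqr_ge0.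
  have dl4 : 0 < dl / 4 by rewrite divr_gt0.
  move/cvgrPdist_le : cv => /(_ _ dl4) cv.
  near=> n; have n0 : (0 < n)%N by near: n; exact: nbhs_infty_gt.
  have r0 := rn0 n n0.
  rewrite ler_pdivlMr// leNgt; apply/negP => MA.
  have ML : Num.max (norm1 (mu n)) (norm2 (mu n) ^+ 2) <= L * Num.sqrt n%:R.
    by apply: le_trans (ltW MA) _; rewrite ler_pM2r// ler_norm.
  have := test_accept (hxi n) n0 hC z0 (hmu n) L0 ML; rewrite -/dl -/C2.
  have : C2 / Num.sqrt n%:R <= dl / 4.
    rewrite ler_pdivrMr// -ler_pdivrMl//; near: n; exact: sqrt_oo.
  have : `|1 - expect (xi n) (mu n) (psi n)| <= dl / 4 by near: n.
  by rewrite ler_norml => /andP[_]; lra.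
move=> Moo; apply/cvgrPdist_le => e e0.
have m1 := @mass_ge1_gt0 R; have s0 := @pos2_sd_gt0 R; have v0 := @pos2_var_gt0 R.
pose c0 : R := 16 * pos2_sd ^+ 2 / mass_ge1 ^+ 2; pose c1 : R := 4 * sq_mean R / pos2_var.
have c00 : 0 <= c0 by rewrite divr_ge0 ?sqr_ge0// mulr_ge0 ?sqr_ge0.
have c10 : 0 <= c1 by rewrite divr_ge0 ?(ltW v0)// mulr_ge0 ?sq_mean_ge0.
move/cvgryPge : Moo => Moo.
near=> n; have n0 : (0 < n)%N by near: n; exact: nbhs_infty_gt.
have r0 := rn0 n n0.
have r1 : 1 <= Num.sqrt (n%:R : R) by near: n; exact: sqrt_oo.
have Q1 : 1 <= Num.max (norm1 (mu n)) (norm2 (mu n) ^+ 2) / Num.sqrt n%:R.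
  by near: n; exact: Moo.
have Q2 : 2 * z * pos2_sd / mass_ge1 <= Num.max (norm1 (mu n)) (norm2 (mu n) ^+ 2) / Num.sqrt n%:R.
  by near: n; exact: Moo.
have Q3 : c0 * (1 + c1) / e <= Num.max (norm1 (mu n)) (norm2 (mu n) ^+ 2) / Num.sqrt n%:R.
  by near: n; exact: Moo.
set M := Num.max _ _ in Q1 Q2 Q3; set r := Num.sqrt _ in r0 r1 Q1 Q2 Q3.
have M0 : 0 < M by move: Q1; rewrite ler_pdivlMr// mul1r; apply: lt_le_trans.
have hM : 2 * z * r * pos2_sd <= mass_ge1 * M.
  move: Q2; rewrite ler_pdivlMr// mulrAC ler_pdivrMr//; lra.
have := test_power (hxi n) n0 z0 (hmu n) M0 hM.
have := test_le1 (hxi n) n0 z (mu n).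
rewrite -/K -/(psi n) -/c0 -/c1 -/M.
set p := expect _ _ _ => p1 p2.
rewrite ger0_norm ?subr_ge0//.
suff : c0 * ((n%:R + c1 * M) / M ^+ 2) <= e by lra.
have nE : n%:R = r ^+ 2 by rewrite sqr_sqrtr.
set q := M / r in Q1 Q3.
have q0 : 0 < q by rewrite divr_gt0.
have ME : M = q * r by rewrite /q divfK// gt_eqF.
(* Since [n%:R = r ^+ 2], the bound depends on the ratio [q] of signal to [r]. *)
have -> : c0 * ((n%:R + c1 * M) / M ^+ 2) = c0 * (q^-1 + c1 / r) / q.
  by rewrite nE ME; field; rewrite !gt_eqF.
rewrite ler_pdivrMr//.
apply: (@le_trans _ _ (c0 * (1 + c1))).
  apply: ler_wpM2l => //; apply: lerD; first by rewrite invf_le1.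
  by rewrite ler_pdivrMr// ler_peMr.
by move: Q3; rewrite ler_pdivrMr// [leRHS]mulrC.
Unshelve. all: by end_near. Qed.
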